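(* Let $\widetilde S$ be a proper spacelike surface in $\widetilde{\mathrm{AdS}}$, with projection $S\subset\mathbb{ADS}$, and let $\partial S\subset\mathrm{Ein}_2$ be the projection of its boundary. Then the invisible domain $E(\partial S)$ is equal to $T_0(S)$ (the Cauchy development of $S$).
   Context: Let $E=\mathbb R^4$ with $Q=-u^2-v^2+x_1^2+x_2^2$ and bilinear form $\langle\cdot\mid\cdot\rangle$, $S(E)$ the space of rays of $E$, $\mathbb{ADS}=\{[x]\in S(E):Q(x)<0\}$ (identified with $\mathrm{AdS}=\{Q=-1\}$), $\mathrm{Ein}_2=\{[x]\in S(E):Q(x)=0\}$. The sign of $\langle x\mid y\rangle$ is well defined for $[x],[y]\in S(E)$. Let $\mathbb D^2=\{p\in S^2:p_3>0\}$ and $d$ the spherical distance. The map $\overline{\mathbb D}^2\times\mathbb R\to S(E)$, $(p,\theta)\mapsto[(\cos\theta,\sin\theta,p_1,p_2)]$ identifies $\mathbb D^2\times\mathbb R$ with the universal covering $\widetilde{\mathrm{AdS}}$ of $\mathrm{AdS}$ and $\partial\mathbb D^2\times\mathbb R$ with the infinite cyclic covering $\widehat{\mathrm{Ein}}_2$ of $\mathrm{Ein}_2$. A proper spacelike surface in $\widetilde{\mathrm{AdS}}$ is a connected properly embedded surface without boundary which is locally the graph of a contracting map ($|f(x)-f(y)|<d(x,y)$ for $x\neq y$) from $\mathbb D^2$ to $\mathbb R$; it is then globally the graph of such a map $f:\mathbb D^2\to\mathbb R$, which extends to a $1$-Lipschitz map on $\overline{\mathbb D}^2$; its boundary $\partial\widetilde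 S\subset\widehat{\mathrm{Ein}}_2$ is the graph of the extension on $\partial\mathbb D^2$. For $x\in\mathbb{ADS}$, the affine domain is $A(x)=\{y\in\mathbb{ADS}:\langle x\mid y\rangle<0\}$. $T(S)=\{x\in\mathbb{ADS}:S\subset A(x)\}$ and $T_0(S)$ is the interior of $T(S)$ (it is the one-to-one image in $\mathbb{ADS}$ of the Cauchy development of $\widetilde S$). The invisible domain is $E(\partial S)=\{[v]\in S(E):\langle v\mid x\rangle<0\ \text{for every }[x]\in\partial S\}$.
   Formalization: T_0(S) is taken to be the projection of the Cauchy development of the surface, not the interior of T(S); with the interior of T(S) the claim fails, e.g. for the graph of p ↦ (9/10)p_3 and the point (cos 1, −sin 1, 0, 0). *)

(* Defs.v *)
From HB Require Import structures.
From mathcomp Require Import all_boot all_order all_algebra.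
From mathcomp Require Import all_classical all_reals all_analysis.

Set Implicit Arguments.
Unset Strict Implicit.
Unset Printing Implicit Defensive.

Import Order.TTheory GRing.Theory Num.Theory.
Import numFieldNormedType.Exports.

Local Open Scope classical_set_scope.
Local Open Scope ring_scope.

(* E = R^4 with coordinates (u, v, x1, x2) of index 0, 1, 2, 3. *)
Definition ads_form (R : realType) (x y : 'rV[R]_4) : R :=
  - (x 0 0 * y 0 0) - x 0 1 * y 0 1 + x 0 2 * y 0 2 + x 0 3 * y 0 3.

(* The class [v] in S(E) is the open half-line spanned by v; it is a point of
   S(E) when v != 0. *)
Definition ray (R : realType) (v : 'rV[R]_4) : set 'rV[R]_4 :=
  [set a *: v | a in [set a : R | 0 < a]].

(* In R^3, the coordinates p_1, p_2, p_3 have index 0, 1, 2. *)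
Definition dot3 (R : realType) (p q : 'rV[R]_3) : R :=
  \sum_(i < 3) p 0 i * q 0 i.

Definition sphere_dist (R : realType) (p q : 'rV[R]_3) : R := acos (dot3 p q).

Definition disk (R : realType) : set 'rV[R]_3 :=
  [set p | dot3 p p = 1 /\ 0 < p 0 2].

Definition closed_disk (R : realType) : set 'rV[R]_3 :=
  [set p | dot3 p p = 1 /\ 0 <= p 0 2].

Definition circle (R : realType) : set 'rV[R]_3 :=
  [set p | dot3 p p = 1 /\ p 0 2 = 0].

(* The universal covering of AdS, as a subset of R^3 x R; its topology is the
   one induced by R^3 x R. *)
Definition AdS_cover (R : realType) : set ('rV[R]_3 * R) := @disk R `*` setT.

(* The map (p, theta) |-> [(cos theta, sin theta, p_1, p_2)] into S(E). *)
Definition ray_proj (R : realType) (x : 'rV[R]_3 * R) : set 'rV[R]_4 :=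
  ray (\row_(i < 4) [:: cos x.2; sin x.2; x.1 0 0; x.1 0 1]`_i).

Definition graph_on (R : realType) (V : set 'rV[R]_3) (f : 'rV[R]_3 -> R) :
    set ('rV[R]_3 * R) :=
  [set x | V x.1 /\ x.2 = f x.1].

Definition contracting_on (R : realType) (V : set 'rV[R]_3)
    (f : 'rV[R]_3 -> R) : Prop :=
  forall p q, V p -> V q -> p <> q -> `|f p - f q| < sphere_dist p q.

Definition lipschitz1_on (R : realType) (V : set 'rV[R]_3)
    (f : 'rV[R]_3 -> R) : Prop :=
  forall p q, V p -> V q -> `|f p - f q| <= sphere_dist p q.

(* Properness of the inclusion is closedness in the covering space.  The local
   graphs are over (relatively) open subsets U `&` disk of the disk, so that
   a set satisfying the last condition is an embedded topological surface
   without boundary. *)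
Definition proper_spacelike_surface (R : realType)
    (S : set ('rV[R]_3 * R)) : Prop :=
  [/\ S `<=` @AdS_cover R,
      S !=set0,
      connected S,
      closure S `&` @AdS_cover R `<=` S &
      forall x, S x ->
        exists (W : set ('rV[R]_3 * R)) (U : set 'rV[R]_3)
               (f : 'rV[R]_3 -> R),
          [/\ open W, W x, open U, contracting_on (U `&` @disk R) f &
              S `&` W = graph_on (U `&` @disk R) f]].

(* The graph over the circle of the extension to the closed disk of the map
   whose graph is S; that map and its extension are unique. *)
Definition surface_boundary (R : realType) (S : set ('rV[R]_3 * R)) :
    set ('rV[R]_3 * R) :=
  [set x | exists f : 'rV[R]_3 -> R,
     [/\ S = graph_on (@disk R) f,
         contracting_on (@disk R) f,
         lipschitz1_on (@closed_disk R) f &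
         graph_on (@circle R) f x]].

Definition invisible_domain (R : realType) (L : set (set 'rV[R]_4)) :
    set (set 'rV[R]_4) :=
  [set ray v | v in [set v : 'rV[R]_4 |
     v != 0 /\ forall x : 'rV[R]_4, L (ray x) -> ads_form v x < 0]].

(* The covering metric is conformal to (spherical metric) - dtheta^2, so the
   point (q, theta') is in the causal future of (p, theta) if and only if
   d(p, q) <= theta' - theta.  Curves without endpoints have an open interval
   as domain, which is taken to be R. *)
Definition inextensible_causal_curve (R : realType)
    (c : R -> 'rV[R]_3 * R) : Prop :=
  [/\ continuous c,
      forall s, @AdS_cover R (c s),
      forall s t, s < t ->
        (c s).2 < (c t).2 /\ sphere_dist (c s).1 (c t).1 <= (c t).2 - (c s).2,
      ~ (exists2 y, @AdS_cover R y & c s @[s --> +oo] --> y) &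
      ~ (exists2 y, @AdS_cover R y & c s @[s --> -oo] --> y)].

(* Cauchy development in the standard sense.  Its projection to ADS is not the
   interior of {x in ADS | <x|y> < 0 for all y in the projection of S}: when S
   is the graph of p |-> (9/10) p_3, that set misses (cos 1, - sin 1, 0, 0),
   because its product with the projection of ((0, 0, 1), 9/10) is
   - cos (19/10) > 0, although (cos 1, - sin 1, 0, 0) projects from the point
   ((0, 0, 1), -1) of the Cauchy development and has product - cos 1 < 0 with
   every projected boundary point (1, 0, p_1, p_2). *)
Definition Cauchy_development (R : realType) (S : set ('rV[R]_3 * R)) :
    set ('rV[R]_3 * R) :=
  [set x | @AdS_cover R x /\
     forall c : R -> 'rV[R]_3 * R,
       inextensible_causal_curve c -> range c x -> exists s, S (c s)].

(* Main.v *)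
Require Import Defs.
From mathcomp Require Import all_boot all_order all_algebra.
From mathcomp Require Import all_classical all_reals all_analysis.
From mathcomp Require Import ring lra.

(* The surface is the graph of a contracting map on the open disk: over a
   compact cap the local graphs have a uniform size, so that the surface can be
   continued along segments from a base point, and connectedness leaves no room
   for a second sheet.  Let [f] be its 1-Lipschitz extension to the closed disk.
   Both sides of the equality then consist of the projections of the points
   [(p, theta)] such that [`|theta - f xi| < d(p, xi)] for all [xi] in the
   circle.
   If this holds at [(p, theta)], a causal curve through [(p, theta)] which
   stays below (or above) the graph of [f] is bounded in time, hence converges
   to a point over the circle, which the inequality excludes.  If it fails at
   [xi], the null geodesic joining [(p, theta)] to the boundary over [xi],
   continued by a vertical half-line, avoids the surface.
   The product of [(p, theta)] with a boundary point is
   [cos d(p, xi) - cos (theta - f xi)].  So the inequality makes it negative;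
   conversely negativity gives it modulo [2 pi], and one lift [theta] serves
   for all [xi] because a spherical triangle has perimeter at most [2 pi]. *)

Set Implicit Arguments.
Unset Strict Implicit.
Unset Printing Implicit Defensive.

Import Order.TTheory GRing.Theory Num.Theory.
Import numFieldNormedType.Exports.

Local Open Scope classical_set_scope.
Local Open Scope ring_scope.

(** * Spherical distance *)

(** Half-angle formula, then [sin y ^+ 2 <= y ^+ 2]. On unit vectors this bounds a chord by its arc,
    hence coordinate differences by the spherical distance. *)
Lemma one_sub_cos_le (R : realType) (x : R) : 2 * (1 - cos x) <= x ^+ 2.
Proof.
have sin_le (y : R) : 0 <= y -> sin y <= y.
  move=> y0.
  have [->|yn0] := eqVneq y 0; first by rewrite sin0.
  have y_gt0 : 0 < y by rewrite lt_neqAle eq_sym yn0.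
  have [c _] := @MVT_segment R sin cos 0 y y0 (fun z _ => is_derive_sin z)
    (continuous_subspaceT (@continuous_sin R)).
  rewrite sin0 !subr0 => ->.
  by rewrite ler_piMl// cos_le1.
have sin2_le (y : R) : sin y ^+ 2 <= y ^+ 2.
  wlog y0 : y / 0 <= y.
    move=> H; have [/H//|/ltW y0] := leP 0 y.
    by rewrite -[leRHS]sqrrN -[leLHS]sqrrN -sinN H// oppr_ge0.
  have h1 := sin_le y y0; have h2 := sin_geN1 y; have h3 := sin_le1 y.
  have [y1|y1] := leP y 1; last by nra.
  have : 0 <= sin y.
    apply: sin_ge0_pi; rewrite y0/=; apply: (le_trans y1).
    by apply: le_trans (@pi_ge2 R); rewrite ler1n.
  nra.
have -> : x = (x / 2) *+ 2 by rewrite mulr2n; field.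
rewrite cos_mulr2n; have := sin2_le (x / 2); rewrite sin2cos2 !mulr2n; nra.
Qed.

Section Sphere.
Variable R : realType.
Implicit Types (p q r u v : 'rV[R]_3) (a b : R).

Lemma dot3E p q :
  dot3 p q = p 0 0 * q 0 0 + p 0 1 * q 0 1 + p 0 2 * q 0 2.
Proof.
rewrite /dot3 !big_ord_recl big_ord0 addr0 !addrA.
by congr (_ + _ * _ + _ * _); congr (_ _ _); apply: val_inj.
Qed.

Lemma dot3C p q : dot3 p q = dot3 q p.
Proof. by rewrite !dot3E; ring. Qed.

Lemma dot3Dl p q r : dot3 (p + q) r = dot3 p r + dot3 q r.
Proof. by rewrite !dot3E !mxE; ring. Qed.

Lemma dot3Zl a p r : dot3 (a *: p) r = a * dot3 p r.
Proof. by rewrite !dot3E !mxE; ring. Qed.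

Lemma dot3Nl p r : dot3 (- p) r = - dot3 p r.
Proof. by rewrite !dot3E !mxE; ring. Qed.

Lemma dot3Dr p q r : dot3 r (p + q) = dot3 r p + dot3 r q.
Proof. by rewrite !dot3E !mxE; ring. Qed.

Lemma dot3Zr a p r : dot3 r (a *: p) = a * dot3 r p.
Proof. by rewrite !dot3E !mxE; ring. Qed.

Lemma dot3Nr p r : dot3 r (- p) = - dot3 r p.
Proof. by rewrite !dot3E !mxE; ring. Qed.

Definition dot3_linear := (dot3Dl, dot3Dr, dot3Zl, dot3Zr, dot3Nl, dot3Nr).

Lemma dot3_ge0 p : 0 <= dot3 p p.
Proof. by rewrite dot3E -!expr2 !addr_ge0// sqr_ge0. Qed.

Lemma sqr_coord_le_dot3 p (i : 'I_3) : p 0 i ^+ 2 <= dot3 p p.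
Proof.
rewrite /dot3 (bigD1 i)//= -expr2 lerDl sumr_ge0// => j _.
by rewrite -expr2 sqr_ge0.
Qed.

Lemma dot3_eq0 p : dot3 p p = 0 -> p = 0.
Proof.
move=> p0; apply/rowP => i; rewrite mxE; apply/eqP.
by rewrite -sqrf_eq0 eq_le sqr_ge0 andbT -p0 sqr_coord_le_dot3.
Qed.

Lemma dot3_CauchySchwarz p q : dot3 p q ^+ 2 <= dot3 p p * dot3 q q.
Proof.
rewrite -subr_ge0.
have -> : dot3 p p * dot3 q q - dot3 p q ^+ 2 =
    (p 0 0 * q 0 1 - p 0 1 * q 0 0) ^+ 2 +
    (p 0 0 * q 0 2 - p 0 2 * q 0 0) ^+ 2 +
    (p 0 1 * q 0 2 - p 0 2 * q 0 1) ^+ 2 by rewrite !dot3E; ring.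
by rewrite !addr_ge0// sqr_ge0.
Qed.

Lemma dot3B p q : dot3 (p - q) (p - q) = dot3 p p + dot3 q q - 2 * dot3 p q.
Proof. by rewrite !dot3_linear (dot3C q p); ring. Qed.

Definition sphere : set 'rV[R]_3 := [set p | dot3 p p = 1].

Lemma sphereN p : sphere p -> sphere (- p).
Proof. by rewrite /sphere/= !dot3_linear opprK. Qed.

Lemma dot3_sphere p q : sphere p -> sphere q -> -1 <= dot3 p q <= 1.
Proof.
rewrite /sphere/= => hp hq.
have := dot3_ge0 (p - q); have := dot3_ge0 (p + q).
rewrite !dot3_linear hp hq (dot3C q p) => *; lra.
Qed.

Lemma cos_sphere_dist p q : sphere p -> sphere q ->
  cos (sphere_dist p q) = dot3 p q.
Proof. by move=> hp hq; rewrite acosK// in_itv/= dot3_sphere. Qed.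

Lemma sphere_dist_ge0 p q : sphere p -> sphere q -> 0 <= sphere_dist p q.
Proof. by move=> hp hq; rewrite acos_ge0// dot3_sphere. Qed.

Lemma sphere_dist_lepi p q : sphere p -> sphere q -> sphere_dist p q <= pi.
Proof. by move=> hp hq; rewrite acos_lepi// dot3_sphere. Qed.

Lemma sphere_distC p q : sphere_dist p q = sphere_dist q p.
Proof. by rewrite /sphere_dist dot3C. Qed.

Lemma sphere_distxx p : sphere p -> sphere_dist p p = 0.
Proof. by rewrite /sphere_dist /sphere/= => ->; rewrite acos1. Qed.

Lemma sphere_distN p q : sphere p -> sphere q ->
  sphere_dist p (- q) = pi - sphere_dist p q.
Proof. by move=> hp hq; rewrite /sphere_dist dot3Nr acosN// dot3_sphere. Qed.

Lemma sphere_dist_eqE p q a : sphere p -> sphere q -> 0 <= a <= pi ->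
  cos a = dot3 p q -> sphere_dist p q = a.
Proof.
move=> hp hq a0 ca; apply: cos_inj => //; last by rewrite cos_sphere_dist.
by rewrite in_itv/= sphere_dist_ge0// sphere_dist_lepi.
Qed.

Lemma sphere_dist_leE p q a : sphere p -> sphere q -> 0 <= a <= pi ->
  (sphere_dist p q <= a) = (cos a <= dot3 p q).
Proof.
move=> hp hq a0; rewrite -cos_sphere_dist// !leNgt; congr negb.
by rewrite ltr_cos// in_itv/= sphere_dist_ge0//= sphere_dist_lepi.
Qed.

Lemma sphere_dist_ltE p q a : sphere p -> sphere q -> 0 <= a <= pi ->
  (sphere_dist p q < a) = (cos a < dot3 p q).
Proof.
move=> hp hq a0; rewrite -cos_sphere_dist// ltr_cos// in_itv/=.
by rewrite sphere_dist_ge0//= sphere_dist_lepi.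
Qed.

Lemma sphere_dist_gt0 p q : sphere p -> sphere q -> p <> q ->
  0 < sphere_dist p q.
Proof.
move=> hp hq npq; rewrite lt_neqAle sphere_dist_ge0// andbT.
apply/eqP => d0; apply: npq; apply/eqP; rewrite -subr_eq0; apply/eqP/dot3_eq0.
have := cos_sphere_dist hp hq; rewrite -d0 cos0 dot3B => <-.
by rewrite hp hq; ring.
Qed.

(** Cauchy-Schwarz for the components of [p] and [r] orthogonal to [q], whose norms are [sin a] and
    [sin b], gives [cos (a + b) <= dot3 p r]. This settles [a + b <= pi]; beyond [pi] the diameter
    bound suffices. *)
Lemma sphere_dist_triangle q p r : sphere p -> sphere q -> sphere r ->
  sphere_dist p r <= sphere_dist p q + sphere_dist q r.
Proof.
move=> hp hq hr; set a := sphere_dist p q; set b := sphere_dist q r.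
have a0 : 0 <= a by exact: sphere_dist_ge0.
have b0 : 0 <= b by exact: sphere_dist_ge0.
have api : a <= pi by exact: sphere_dist_lepi.
have bpi : b <= pi by exact: sphere_dist_lepi.
have [/ltW abpi|abpi] := ltP pi (a + b).
  exact: le_trans (sphere_dist_lepi hp hr) abpi.
rewrite sphere_dist_leE// ?addr_ge0//=.
have ca : dot3 p q = cos a by rewrite cos_sphere_dist.
have cb : dot3 q r = cos b by rewrite cos_sphere_dist.
rewrite cosD.
have := dot3_CauchySchwarz (p - cos a *: q) (r - cos b *: q).
rewrite !dot3_linear (dot3C q p) (dot3C r q) ca cb hp hq hr.
move: (dot3 p r) => c CS.
have {}CS : (cos a * cos b - c) ^+ 2 <= (sin a * sin b) ^+ 2.
  rewrite exprMn !sin2cos2; apply: le_trans (le_trans CS _).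
    by rewrite le_eqVlt; apply/orP; left; apply/eqP; ring.
  by rewrite le_eqVlt; apply/orP; left; apply/eqP; ring.
have sab : 0 <= sin a * sin b by rewrite mulr_ge0// sin_ge0_pi ?a0 ?b0.
move: (cos a * cos b) (sin a * sin b) sab CS => X Y Y0 CS.
rewrite leNgt; apply/negP => h; clear -Y0 CS h.
have : 0 < (X - c - Y) * (X - c + Y) by apply: mulr_gt0; lra.
by lra.
Qed.

(** Triangle inequality from [q] to [r] through the antipode of [p]. *)
Lemma sphere_perimeter_le p q r : sphere p -> sphere q -> sphere r ->
  sphere_dist p q + sphere_dist q r + sphere_dist r p <= pi *+ 2.
Proof.
move=> hp hq hr; have := sphere_dist_triangle hq (sphereN hp) hr.
rewrite (sphere_distC (- p) r) (sphere_distN hq hp) (sphere_distN hr hp).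
by rewrite (sphere_distC q p) mulr2n; lra.
Qed.

(** With [z] the distance from [p] to [q], the two partial distances have sines [b * sin z] and
    [a * sin z], so the cosine of their sum is [cos z]. Injectivity of the cosine concludes once the
    sum is at most [pi]. *)
Lemma sphere_dist_comb p q m a b : sphere p -> sphere q -> sphere m ->
  0 <= a -> 0 <= b -> m = a *: p + b *: q ->
  sphere_dist p m + sphere_dist m q = sphere_dist p q.
Proof.
move=> hp hq hm a0 b0 mE.
have pm : dot3 p m = a + b * dot3 p q by rewrite mE !dot3_linear hp; ring.
have mq : dot3 m q = a * dot3 p q + b by rewrite mE !dot3_linear hq; ring.
have : a * dot3 p m + b * dot3 m q = 1.
  by rewrite -hm {3}mE !dot3_linear (dot3C q m) (dot3C p m).
rewrite pm mq.
have := cos_sphere_dist hp hm; have := cos_sphere_dist hm hq.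
have := cos_sphere_dist hp hq; rewrite pm mq.
have := sphere_dist_ge0 hp hm; have := sphere_dist_ge0 hm hq.
have := sphere_dist_lepi hp hm; have := sphere_dist_lepi hm hq.
have := sphere_dist_ge0 hp hq; have := sphere_dist_lepi hp hq.
have /andP[C1 C2] := dot3_sphere hp hq.
move: (sphere_dist p m) (sphere_dist m q) (sphere_dist p q) => x y z.
move: (dot3 p q) C1 C2 => C C1 C2 zpi z0 ypi xpi y0 x0 cz cy cx n1.
have sz0 : 0 <= sin z by rewrite sin_ge0_pi ?z0.
have sz : sin z ^+ 2 = 1 - C ^+ 2 by rewrite sin2cos2 cz.
have sx : sin x = b * sin z.
  apply/eqP; rewrite -(@eqrXn2 _ 2)//; last 2 first.
  - by rewrite sin_ge0_pi ?x0.
  - by rewrite mulr_ge0.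
  by rewrite exprMn sin2cos2 sz cx; apply/eqP; lra.
have sy : sin y = a * sin z.
  apply/eqP; rewrite -(@eqrXn2 _ 2)//; last 2 first.
  - by rewrite sin_ge0_pi ?y0.
  - by rewrite mulr_ge0.
  by rewrite exprMn sin2cos2 sz cy; apply/eqP; lra.
have cxy : cos (x + y) = cos z.
  rewrite cosD sx sy cx cy cz mulrACA -expr2 sz -[RHS]mulr1 -[X in _ = _ * X]n1; ring.
apply: cos_inj => //; rewrite in_itv/= ?z0// addr_ge0//=.
(* The sum is at most [pi] because [cos x + cos y = (a + b) * (1 + C)] is nonnegative. *)
rewrite -lerBrDr leNgt -ltr_cos ?in_itv/= ?x0//; last first.
  by rewrite subr_ge0 ypi/= lerBlDr lerDl.
rewrite -leNgt addrC cosDpi cosN cx cy.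
have : 0 <= (a + b) * (1 + C) by rewrite mulr_ge0//; lra.
lra.
Qed.

Lemma coord_le_sphere_dist p q (i : 'I_3) : sphere p -> sphere q ->
  `|p 0 i - q 0 i| <= sphere_dist p q.
Proof.
move=> hp hq; rewrite -(ler_pXn2r (_ : 0 < 2)%N) ?nnegrE ?sphere_dist_ge0//.
rewrite real_normK ?num_real//.
have -> : p 0 i - q 0 i = (p - q) 0 i by rewrite !mxE.
apply: le_trans (sqr_coord_le_dot3 _ _) _.
apply: le_trans (one_sub_cos_le _); rewrite cos_sphere_dist// dot3B hp hq.
by rewrite le_eqVlt; apply/orP; left; apply/eqP; ring.
Qed.

(** * Radial projection onto the sphere, midpoints and continuity *)

Definition normalize v : 'rV[R]_3 := (Num.sqrt (dot3 v v))^-1 *: v.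

Lemma sphere_normalize v : 0 < dot3 v v -> sphere (normalize v).
Proof.
move=> v0; rewrite /sphere/= !dot3_linear mulrA -invfM -expr2.
by rewrite sqr_sqrtr ?ltW// mulVf// gt_eqF.
Qed.

Lemma normalize_id p : sphere p -> normalize p = p.
Proof. by rewrite /normalize => ->; rewrite sqrtr1 invr1 scale1r. Qed.

(** With norms [x] and [y], the squared chord is [(x - y) ^+ 2] plus [2 * x * y] times one minus the
    cosine of the angle, and [x * y] is at least [a ^+ 2]. This is a uniform continuity of radial
    projection away from the origin. *)
Lemma sphere_dist_normalize_lt u v a e : 0 < a -> 0 < e <= pi ->
  a ^+ 2 <= dot3 u u -> a ^+ 2 <= dot3 v v ->
  dot3 (u - v) (u - v) < a ^+ 2 * (2 * (1 - cos e)) ->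
  sphere_dist (normalize u) (normalize v) < e.
Proof.
move=> a0 /andP[e0 epi] au av uv.
have a20 : 0 < a ^+ 2 by rewrite exprn_gt0.
have u0 : 0 < dot3 u u by exact: lt_le_trans au.
have v0 : 0 < dot3 v v by exact: lt_le_trans av.
rewrite sphere_dist_ltE ?(ltW e0)//; [|exact: sphere_normalize..].
rewrite !dot3_linear.
set x := Num.sqrt (dot3 u u); set y := Num.sqrt (dot3 v v).
have xE : dot3 u u = x ^+ 2 by rewrite sqr_sqrtr// ltW.
have yE : dot3 v v = y ^+ 2 by rewrite sqr_sqrtr// ltW.
have ax : a <= x by rewrite -(ler_pXn2r (_ : 0 < 2)%N) ?nnegrE ?sqrtr_ge0 -?xE// ltW.
have ay : a <= y by rewrite -(ler_pXn2r (_ : 0 < 2)%N) ?nnegrE ?sqrtr_ge0 -?yE// ltW.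
have x0 : 0 < x by exact: lt_le_trans ax.
have y0 : 0 < y by exact: lt_le_trans ay.
move: uv; rewrite dot3B xE yE; move: (dot3 u v) => d uv.
rewrite mulrA -invfM mulrC ltr_pdivlMr ?mulr_gt0//.
have ce : 0 <= 1 - cos e by rewrite subr_ge0 cos_le1.
have axy : a ^+ 2 <= y * x by rewrite expr2 ler_pM// ltW.
have := ler_wpM2r ce axy.
have := sqr_ge0 (x - y).
move: uv; move: (cos e) (a ^+ 2) => C A; nra.
Qed.

(** The midpoint is [p + q] divided by its norm. That norm is at most 2, so the height is at least
    the average of the two heights; hence sets bounded below in height are stable under
    midpoints. *)
Lemma sphere_midpoint p q : sphere p -> sphere q -> 0 < p 0 2 -> 0 <= q 0 2 ->
  exists m, [/\ sphere m, sphere_dist p m = sphere_dist p q / 2,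
    sphere_dist m q = sphere_dist p q / 2, 0 < m 0 2 &
    forall c, 0 <= c -> c <= p 0 2 -> c <= q 0 2 -> c <= m 0 2].
Proof.
move=> hp hq p0 q0; set v := p + q.
have v2 : v 0 2 = p 0 2 + q 0 2 by rewrite mxE.
have vv : 0 < dot3 v v.
  apply: lt_le_trans (sqr_coord_le_dot3 v 2); rewrite v2 exprn_gt0//; lra.
have x0 : 0 < Num.sqrt (dot3 v v) by rewrite sqrtr_gt0.
have x2 : Num.sqrt (dot3 v v) <= 2.
  rewrite -(ler_pXn2r (_ : 0 < 2)%N) ?nnegrE ?sqrtr_ge0// sqr_sqrtr ?(ltW vv)//.
  rewrite /v !dot3_linear (dot3C q p) hp hq.
  have /andP[] := dot3_sphere hp hq; lra.
have hm : sphere (normalize v) by exact: sphere_normalize.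
have m2 : normalize v 0 2 = (p 0 2 + q 0 2) / Num.sqrt (dot3 v v).
  by rewrite mxE v2 mulrC.
have pm_mq : sphere_dist p (normalize v) = sphere_dist (normalize v) q.
  rewrite /sphere_dist !dot3_linear hp hq; congr (acos (_ * _)).
  by rewrite addrC.
have := @sphere_dist_comb p q (normalize v) (Num.sqrt (dot3 v v))^-1
  (Num.sqrt (dot3 v v))^-1 hp hq hm.
rewrite invr_ge0 sqrtr_ge0 /normalize scalerDr => /(_ isT isT erefl).
rewrite -scalerDr -/v -/(normalize v) => sum.
exists (normalize v); split => //; first 2 last.
- by rewrite m2 divr_gt0// ltr_wpDr.
- move=> c c0 cp cq; rewrite m2 ler_pdivlMr//.
  by apply: le_trans (ler_wpM2l c0 x2) _; lra.
- by rewrite -sum -pm_mq; field.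
- by rewrite -sum pm_mq; field.
Qed.

Lemma cvg_dot3 (T : Type) (F : set_system T) {FF : Filter F}
    (f g : T -> 'rV[R]_3) p q :
  f @ F --> p -> g @ F --> q -> dot3 (f x) (g x) @[x --> F] --> dot3 p q.
Proof.
move=> fp gq.
have coordc (h : T -> 'rV[R]_3) (r : 'rV[R]_3) (i : 'I_3) :
    h @ F --> r -> h x 0 i @[x --> F] --> r 0 i.
  by move=> hr; exact: cvg_comp hr (@coord_continuous R 1 3 0 i r).
rewrite dot3E; under eq_fun do rewrite dot3E.
by apply: cvgD; [apply: cvgD|]; apply: cvgM; apply: coordc.
Qed.

Lemma nbhs_sphere_dist_lt p e : sphere p -> 0 < e ->
  \forall q \near p, sphere q -> sphere_dist p q < e.
Proof.
move=> hp e0.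
have pi0 := @pi_gt0 R.
set e' := Num.min e pi.
have e'0 : 0 < e' by rewrite lt_min e0.
have e'e : e' <= e by rewrite ge_min lexx.
have e'pi : e' <= pi by rewrite ge_min lexx orbT.
have c1 : cos e' < dot3 p p.
  by rewrite -sphere_dist_ltE// ?(ltW e'0)// sphere_distxx.
have dc : dot3 p x @[x --> p] --> dot3 p p.
  exact: cvg_dot3 (cvg_cst p) (@cvg_id _ (nbhs p)).
apply: filterS (cvgr_gt _ dc _ c1) => q h hq; apply: lt_le_trans e'e.
by rewrite sphere_dist_ltE// (ltW e'0).
Qed.

Lemma nbhs_coord_gt p a (i : 'I_3) : a < p 0 i ->
  \forall q \near p, a < (q : 'rV[R]_3) 0 i.
Proof.
exact: (cvgr_gt (f := fun q : 'rV[R]_3 => q 0 i) _ (@coord_continuous R 1 3 0 i p)).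
Qed.

End Sphere.

(** * Proper spacelike surfaces are graphs over the disk *)

Section GlobalGraph.
Variable R : realType.
Implicit Types (p q r u v : 'rV[R]_3) (x y : 'rV[R]_3 * R)
  (S : set ('rV[R]_3 * R)).

(** For [c > 0] the caps are compact, exhaust the disk and are stable under geodesic arcs; constants
    are made uniform on them. *)
Definition cap (c : R) : set 'rV[R]_3 := [set p | sphere p /\ c <= p 0 2].

Lemma cap_disk c p : 0 < c -> cap c p -> disk p.
Proof. by move=> c0 [? ?]; split => //; exact: lt_le_trans c0 _. Qed.

Lemma compact_cap c : compact (cap c).
Proof.
have K : compact [set v : 'rV[R]_3 | forall i, `[-1, 1]%classic (v ord0 i)].
  apply: (@rV_compact R 3 (fun=> `[-1, 1]%classic)) => i.
  exact: segment_compact.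
apply: subclosed_compact K _; last first.
  move=> p [hp _] i /=; rewrite in_itv/= -ler_norml -(expr_le1 (_ : 0 < 2)%N)//.
  by rewrite real_normK ?num_real// -hp sqr_coord_le_dot3.
have -> : cap c = (fun q => dot3 q q) @^-1` [set 1] `&`
                  (fun q : 'rV[R]_3 => q 0 2) @^-1` [set x | c <= x].
  by apply/seteqP; split.
apply: closedI; apply: preimage_closed.
- move=> q _; exact: cvg_dot3 (@cvg_id _ (nbhs q)) (@cvg_id _ (nbhs q)).
- exact: closed_eq.
- move=> q _; exact: coord_continuous.
- exact: closed_ge.
Qed.

(** Being a contracting graph at scale [e] around [x], put without a chart: points lift, neighbours
    are strictly spacelike, fibres are met once. With a number as scale, compactness can make it
    uniform. *)
Definition graph_like S (e : R) x : Prop :=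
  (forall q, disk q -> sphere_dist x.1 q < e ->
     exists2 t, S (q, t) & `|t - x.2| <= sphere_dist x.1 q) /\
  (forall y, S y -> sphere_dist x.1 y.1 < e -> `|y.2 - x.2| < e ->
     y.1 <> x.1 -> `|y.2 - x.2| < sphere_dist x.1 y.1) /\
  (forall y, S y -> y.1 = x.1 -> `|y.2 - x.2| < e -> y = x).

Lemma local_graph_like S x : proper_spacelike_surface S -> S x ->
  \forall y \near x & e \near 0^'+, S y -> graph_like S e y.
Proof.
move=> [SD _ _ _ loc] Sx.
have Ds y : S y -> sphere y.1 by move=> /SD[[]].
have [W [U [f [oW Wx oU fU SW]]]] := loc x Sx.
have [Ux xf] : (U `&` @disk R) x.1 /\ x.2 = f x.1.
  by have : (S `&` W) x by []; rewrite SW.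
have [/= r1 r10 r1W] : nbhs_ball x W.
  by apply/nbhs_ballP; exact: open_nbhs_nbhs.
have [/= r2 r20 r2U] : nbhs_ball x.1 U.
  by apply/nbhs_ballP; apply: open_nbhs_nbhs; split => //; case: Ux.
(* The chart applies within [r0] of [x]; halving lets every point within [r] of [x] use it on its
   own ball of radius [r]. *)
pose r0 := Num.min r1 r2; pose r := r0 / 2.
have r00 : 0 < r0 by rewrite lt_min r10.
have r_gt0 : 0 < r by rewrite divr_gt0.
have r0r : r0 = r + r by rewrite /r; field.
have inU q : sphere q -> sphere_dist x.1 q < r0 -> U q.
  move=> hq dq; apply: r2U; split => // i j; rewrite ord1.
  apply: le_lt_trans (coord_le_sphere_dist _ (Ds _ Sx) hq) _.
  by apply: lt_le_trans dq _; rewrite ge_min lexx orbT.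
have inW y : S y -> sphere_dist x.1 y.1 < r0 -> `|x.2 - y.2| < r0 ->
    U y.1 /\ y.2 = f y.1.
  move=> Sy d1 d2.
  have Wy : W y.
    apply: r1W; split => /=; last first.
      by apply: lt_le_trans d2 _; rewrite ge_min lexx.
    split => // i j; rewrite ord1.
    apply: le_lt_trans (coord_le_sphere_dist _ (Ds _ Sx) (Ds _ Sy)) _.
    by apply: lt_le_trans d1 _; rewrite ge_min lexx.
  have : (S `&` W) y by [].
  by rewrite SW => -[[]].
have n1 : \forall y \near x, sphere y.1 -> sphere_dist x.1 y.1 < r.
  have := nbhs_sphere_dist_lt (Ds _ Sx) r_gt0.
  exact: (@cvg_fst _ _ (nbhs x.1) (nbhs x.2)).
have n2 : \forall y \near x, `|x.2 - y.2| < r.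
  have := nbhsx_ballx x.2 r r_gt0.
  exact: (@cvg_snd _ _ (nbhs x.1) (nbhs x.2)).
near=> y e => Sy.
have e0 : 0 < e by near: e; exact: nbhs_right_gt.
have er : e < r by near: e; exact: nbhs_right_lt.
have /(_ (Ds _ Sy)) d1 : sphere y.1 -> sphere_dist x.1 y.1 < r.
  by near: y; exact: n1.
have d2 : `|x.2 - y.2| < r by near: y; exact: n2.
have [Uy yf] : U y.1 /\ y.2 = f y.1.
  by apply: inW => //; rewrite r0r ltr_wpDr// ltW.
have Dy : disk y.1 by have [] := SD _ Sy.
have near_y q : sphere q -> sphere_dist y.1 q < e -> sphere_dist x.1 q < r0.
  move=> hq dq; apply: le_lt_trans (sphere_dist_triangle (Ds _ Sx) (Ds _ Sy) hq) _.
  by rewrite r0r ltrD// (lt_trans dq).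
have near_yt (z : 'rV[R]_3 * R) : `|z.2 - y.2| < e -> `|x.2 - z.2| < r0.
  move=> zy; have -> : x.2 - z.2 = (x.2 - y.2) - (z.2 - y.2) by ring.
  by apply: le_lt_trans (ler_normB _ _) _; rewrite r0r ltrD// (lt_trans zy).
split; [|split].
- move=> q Dq dq; exists (f q).
    have Uq : U q by apply: inU; [case: Dq|apply: near_y => //; case: Dq].
    have : graph_on (U `&` @disk R) f (q, f q) by [].
    by rewrite -SW => -[].
  have [->|/eqP qy] := eqVneq q y.1.
    by rewrite -yf subrr normr0; apply: sphere_dist_ge0; exact: Ds.
  rewrite sphere_distC yf; apply/ltW/fU => //; split=> //.
  by apply: inU; [case: Dq|apply: near_y => //; case: Dq].
- move=> z Sz dz zt zy.
  have [Uz zf] := inW z Sz (near_y _ (Ds _ Sz) dz) (near_yt z zt).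
  rewrite sphere_distC yf zf; apply: fU => //; split => //.
  by have [] := SD _ Sz.
- move=> z Sz zy zt.
  have [|Uz zf] := inW z Sz _ (near_yt z zt).
    by rewrite zy r0r ltr_wpDr// ltW.
  by apply: injective_projections => //; rewrite zf yf zy.
Unshelve. all: by end_near. Qed.

(** Properness enters here: [S] is closed in the covering and the cap stays away from the circle, so
    the part of [S] in the cylinder is compact and one scale serves all its points. *)
Lemma uniform_graph_like S c (a b : R) : proper_spacelike_surface S -> 0 < c ->
  exists2 e, 0 < e <= pi & forall x, S x -> cap c x.1 -> a <= x.2 <= b ->
    graph_like S e x.
Proof.
move=> hS c0; have [SD _ _ clS _] := hS.
have cK : compact (cap c `*` `[a, b]%classic).
  by apply: compact_setX; [exact: compact_cap|exact: segment_compact].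
have clK : closed (cap c `*` `[a, b]%classic).
  by apply: compact_closed (cK); exact: norm_hausdorff.
have cSK : compact (S `&` (cap c `*` `[a, b]%classic)).
  apply: subclosed_compact cK _; last exact: subIsetr.
  move=> x clx.
  have Kx : (cap c `*` `[a, b]%classic) x.
    by apply: clK; apply: closure_subset clx; exact: subIsetr.
  split => //; apply: clS; split.
    by apply: closure_subset clx; exact: subIsetl.
  by split => //; apply: cap_disk c0 _; case: Kx.
have := (compact_near_coveringP _).1 cSK _ (0 : R)^'+
  (fun e x => S x -> graph_like S e x) _.
move=> /(_ _ (fun x Sx => local_graph_like hS Sx.1)) h.
have [e [e0 epi eS]] : exists e : R, [/\ 0 < e, e <= pi &
    S `&` (cap c `*` `[a, b]%classic) `<=` (fun x => S x -> graph_like S e x)].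
  near (0 : R)^'+ => e; exists e; split.
  - by near: e; exact: nbhs_right_gt.
  - by near: e; apply: nbhs_right_le; exact: pi_gt0.
  - by near: e.
exists e; first by rewrite e0.
by move=> x Sx cx ab; apply: eS.
Unshelve. all: by end_near. Qed.

End GlobalGraph.

(** * Continuation of local sections over a cap *)

Section Sections.
Variable R : realType.
Implicit Types (p q r u v : 'rV[R]_3) (x y : 'rV[R]_3 * R)
  (S : set ('rV[R]_3 * R)).

(** Induction on [n] for distances below [2 ^+ n * d]: passing to the midpoint halves the distance
    and stays in the cap. It turns small-scale properties into properties of the whole cap. *)
Lemma cap_midpoint_ind (c d : R) (P : 'rV[R]_3 -> 'rV[R]_3 -> Prop) :
  0 < c -> 0 < d ->
  (forall p q, cap c p -> cap c q -> sphere_dist p q < d -> P p q) ->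
  (forall p m q, cap c p -> cap c m -> cap c q -> p <> q -> p <> m -> m <> q ->
     sphere_dist p m + sphere_dist m q = sphere_dist p q ->
     P p m -> P m q -> P p q) ->
  forall p q, cap c p -> cap c q -> P p q.
Proof.
move=> c0 d0 Psmall Pmid p q cp cq.
have H n : forall p q, cap c p -> cap c q -> sphere_dist p q < 2 ^+ n * d -> P p q.
  elim: n => [|n IH] {cp cq} {}p {}q cp cq; first by rewrite mul1r; exact: Psmall.
  move=> dpq; have [hp pc] := cp; have [hq qc] := cq.
  have [pq|/eqP npq] := eqVneq p q.
    by apply: Psmall => //; rewrite pq sphere_distxx.
  have d_gt0 := sphere_dist_gt0 hp hq npq.
  have p0 := lt_le_trans c0 pc; have q0 := le_trans (ltW c0) qc.
  have [m [hm dpm dmq _ cm]] := sphere_midpoint hp hq p0 q0.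
  have capm : cap c m by split => //; exact: cm (ltW c0) pc qc.
  have half_lt : sphere_dist p q / 2 < 2 ^+ n * d.
    by rewrite ltr_pdivrMr// mulrAC -exprSr.
  apply: (Pmid p m q) => //.
  - by move=> pm; move: dpm; rewrite -pm sphere_distxx//; lra.
  - by move=> mq; move: dmq; rewrite mq sphere_distxx//; lra.
  - by rewrite dpm dmq; field.
  - by apply: IH => //; rewrite dpm.
  - by apply: IH => //; rewrite dmq.
apply: (H (Num.bound (pi / d))) => //.
rewrite -ltr_pdivrMr//; apply: le_lt_trans (upper_nthrootP (leqnn _)).
by rewrite ler_pM2r ?invr_gt0// sphere_dist_lepi//; [case: cp|case: cq].
Qed.

Definition segment p q (t : R) : 'rV[R]_3 := (1 - t) *: p + t *: q.

(** The chord has height at least [c] and norm at most 1, so projecting it to the sphere can only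
    raise it. *)
Lemma cap_normalize_segment c p q (t : R) : 0 < c -> 0 <= t <= 1 ->
  cap c p -> cap c q ->
  c ^+ 2 <= dot3 (segment p q t) (segment p q t) /\
  cap c (normalize (segment p q t)).
Proof.
move=> c0 /andP[t0 t1] [hp pc] [hq qc]; set v := segment p q t.
have v2 : c <= v 0 2.
  have -> : v 0 2 = (1 - t) * p 0 2 + t * q 0 2 by rewrite !mxE.
  nra.
have vv : c ^+ 2 <= dot3 v v.
  apply: le_trans (sqr_coord_le_dot3 v 2).
  by rewrite ler_pXn2r ?nnegrE// ltW// (lt_le_trans c0).
have vv0 : 0 < dot3 v v by apply: lt_le_trans vv; rewrite exprn_gt0.
split => //; split; first exact: sphere_normalize.
have vv1 : dot3 v v <= 1.
  rewrite /v /segment !dot3_linear hp hq (dot3C q p).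
  have /andP[_] := dot3_sphere hp hq; move: (dot3 p q) => C C1.
  have : 0 <= t * (1 - t) * (1 - C) by rewrite !mulr_ge0// subr_ge0.
  lra.
have s1 : Num.sqrt (dot3 v v) <= 1.
  rewrite -(ler_pXn2r (_ : 0 < 2)%N) ?nnegrE ?sqrtr_ge0// expr1n.
  by rewrite sqr_sqrtr ?(ltW vv0).
rewrite mxE mulrC ler_pdivlMr ?sqrtr_gt0//; apply: le_trans v2.
by rewrite ler_piMr// ltW.
Qed.

(** The chord point at [s] combines [p] and the chord point at [t] with the nonnegative weights
    [1 - s / t] and [s / t], so [sphere_dist_comb] applies after normalization. *)
Lemma sphere_dist_segment c p q (s t : R) : 0 < c -> cap c p -> cap c q ->
  0 <= s <= t -> 0 < t <= 1 ->
  sphere_dist p (normalize (segment p q s)) +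
  sphere_dist (normalize (segment p q s)) (normalize (segment p q t)) =
  sphere_dist p (normalize (segment p q t)).
Proof.
move=> c0 cp cq /andP[s0 st] /andP[t0 t1].
have [|vs [hs _]] := @cap_normalize_segment c p q s c0 _ cp cq.
  by rewrite s0 (le_trans st).
have [|vt [ht _]] := @cap_normalize_segment c p q t c0 _ cp cq.
  by rewrite t1 ltW.
have c20 : 0 < c ^+ 2 by rewrite exprn_gt0.
have x0 : 0 < Num.sqrt (dot3 (segment p q t) (segment p q t)).
  by rewrite sqrtr_gt0 (lt_le_trans c20).
rewrite /normalize in hs ht *.
move: (Num.sqrt (dot3 (segment p q t) _)) x0 ht => x x0 ht.
have y0 : 0 < Num.sqrt (dot3 (segment p q s) (segment p q s)).
  by rewrite sqrtr_gt0 (lt_le_trans c20).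
move: (Num.sqrt (dot3 (segment p q s) _)) y0 hs => y y0 hs.
case: cp => hp _.
apply: (@sphere_dist_comb _ _ _ _ (y^-1 * (1 - s / t)) (y^-1 * (s / t) * x)) => //.
- by rewrite mulr_ge0 ?invr_ge0 ?(ltW y0)// subr_ge0 ler_pdivrMr// mul1r.
- by rewrite !mulr_ge0 ?invr_ge0 ?(ltW y0) ?(ltW x0) ?(ltW t0).
- apply/rowP => i; rewrite !mxE; field.
  by rewrite !gt_eqF.
Qed.

(* The continuation of [S] from [x] along the projected segments issued from
   [x.1], in steps below the uniform scale of [S] over a compact cylinder. *)
Lemma cap_section S x c : proper_spacelike_surface S -> S x ->
    0 < c -> c <= x.1 0 2 ->
  exists f, [/\ f x.1 = x.2, forall q, cap c q -> S (q, f q) &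
    contracting_on (cap c) f].
Proof.
move=> hS Sx c0 cx.
have hp : sphere x.1 by case: hS => /(_ _ Sx)[[]].
have capx : cap c x.1 by [].
(* The continuation drifts in time by at most the distance travelled, hence by at most [pi]. *)
have [e /andP[e0 epi] eS] :=
  uniform_graph_like (x.2 - pi) (x.2 + pi) hS c0.
(* In [close_f'] three increments, each below [e / 4], must add up to less than [e]. *)
pose e4 := e / 4.
have e40 : 0 < e4 by rewrite divr_gt0.
have e4pi : e4 <= pi by apply: le_trans epi; rewrite /e4; lra.
(* Vectors of norm at least [c] with squared distance below [h] project to points less than [e4]
   apart. *)
pose h := c ^+ 2 * (2 * (1 - cos e4)).
have h0 : 0 < h.
  rewrite mulr_gt0 ?exprn_gt0// mulr_gt0// subr_gt0.
  by rewrite -cos0 ltr_cos// in_itv/= ?lexx ?pi_ge0// (ltW e40).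
(* A chord has squared length at most 4, so cutting it into [N.+1] equal pieces makes each step
   shorter than [e4] after projection. *)
have [N Nh] : exists N : nat, 4 / N.+1%:R ^+ 2 < h.
  exists (Num.bound (4 / h)); rewrite ltr_pdivrMr ?exprn_gt0//.
  rewrite -ltr_pdivrMl// mulrC.
  have /lt_le_trans : 4 / h < (Num.bound (4 / h)).+1%:R.
    apply: lt_le_trans (archi_boundP _) _; first by rewrite divr_ge0// ltW.
    by rewrite ler_nat.
  by apply; rewrite expr2 ler_peMl// ler1n.
(* [Num.sqrt h] keeps the arcs to two [d]-close end points within [e4] at every stage; [e] serves
   the final contraction estimate. *)
pose d := Num.min e (Num.sqrt h).
have d0 : 0 < d by rewrite lt_min e0 sqrtr_gt0.
have dh q q' : sphere q -> sphere q' -> sphere_dist q q' < d ->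
    dot3 (q - q') (q - q') < h.
  move=> hq hq' dq.
  have : sphere_dist q q' ^+ 2 < h.
    rewrite -(sqr_sqrtr (ltW h0)) ltr_pXn2r ?nnegrE ?sqrtr_ge0 ?sphere_dist_ge0//.
    by apply: lt_le_trans dq _; rewrite ge_min lexx orbT.
  apply: le_lt_trans; apply: le_trans (one_sub_cos_le _).
  by rewrite cos_sphere_dist// dot3B hq hq'; lra.
pose g n q : 'rV[R]_3 := normalize (segment x.1 q (n%:R / N.+1%:R)).
have N0 : 0 < N.+1%:R :> R by rewrite ltr0n.
have tn n : (n <= N.+1)%N -> 0 <= (n%:R / N.+1%:R : R) <= 1.
  by move=> nN; rewrite divr_ge0//= ler_pdivrMr// mul1r ler_nat.
have capg n q : (n <= N.+1)%N -> cap c q -> cap c (g n q).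
  by move=> nN cq; exact: (cap_normalize_segment c0 (tn _ nN) capx cq).2.
(* The first clause keeps the lift in the time range where [e] is valid; the second keeps lifts
   along neighbouring arcs on the same sheet. *)
have Hn n : (n <= N.+1)%N -> exists f : 'rV[R]_3 -> R,
    (forall q, cap c q ->
       S (g n q, f q) /\ `|f q - x.2| <= sphere_dist x.1 (g n q)) /\
    (forall q q', cap c q -> cap c q' -> sphere_dist q q' < d ->
       `|f q - f q'| <= sphere_dist (g n q) (g n q')).
  elim: n => [_|n IH nN].
    have g0 q : g 0%N q = x.1.
      by rewrite /g /segment mul0r subr0 scale0r scale1r addr0 normalize_id.
    exists (fun=> x.2); split=> [q cq|q q' _ _ _].
      by rewrite g0 subrr normr0 sphere_distxx//; split => //; case: (x) Sx.
    by rewrite !g0 subrr normr0 sphere_distxx.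
  have [f [fS f_lip]] := IH (ltnW nN).
  have step q : cap c q -> sphere_dist (g n q) (g n.+1 q) < e4.
    move=> cq; have [hq _] := cq.
    have [vv _] := cap_normalize_segment c0 (tn _ (ltnW nN)) capx cq.
    have [ww _] := cap_normalize_segment c0 (tn _ nN) capx cq.
    apply: sphere_dist_normalize_lt vv ww _; rewrite ?e40//; apply: le_lt_trans Nh.
    have -> : segment x.1 q (n%:R / N.+1%:R) - segment x.1 q (n.+1%:R / N.+1%:R)
        = N.+1%:R^-1 *: (x.1 - q).
      apply/rowP => i; rewrite !mxE -[n.+1%:R]natr1; field.
      by rewrite gt_eqF// -natr1 natr1.
    rewrite dot3Zl dot3Zr dot3B hp hq.
    have /andP[] := dot3_sphere hp hq.
    move: (dot3 x.1 q) => C C1 C2; rewrite mulrA -expr2 exprVn mulrC.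
    by rewrite ler_pM2r ?invr_gt0 ?exprn_gt0//; lra.
  have inbox q t : cap c q -> `|t - x.2| <= sphere_dist x.1 q ->
      S (q, t) -> graph_like S e (q, t).
    move=> cq tq Sqt; apply: eS => //=.
    have dpi : sphere_dist x.1 q <= pi by apply: sphere_dist_lepi => //; case: cq.
    by rewrite -ler_distl (le_trans tq).
  (* One more step of the lift; off the cap the value 0 is a dummy. *)
  have ex q : exists t : R, cap c q -> S (g n.+1 q, t) /\
      `|t - f q| <= sphere_dist (g n q) (g n.+1 q).
    have [cq|ncq] := pselect (cap c q); last by exists 0.
    have [Sq fq] := fS q cq.
    have [lift _] := inbox _ _ (capg _ _ (ltnW nN) cq) fq Sq.
    have [||t St tq] := lift (g n.+1 q).
    - exact: cap_disk c0 (capg _ _ nN cq).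
    - by apply: lt_trans (step _ cq) _; rewrite /e4; lra.
    - by exists t.
  have [f' f'S] := choice ex.
  have f'x q : cap c q -> `|f' q - x.2| <= sphere_dist x.1 (g n.+1 q).
    move=> cq; have -> : f' q - x.2 = (f' q - f q) + (f q - x.2) by ring.
    apply: le_trans (ler_normD _ _) _.
    rewrite -(@sphere_dist_segment c x.1 q (n%:R / N.+1%:R) (n.+1%:R / N.+1%:R))//.
    - by rewrite addrC lerD//; [exact: (fS q cq).2|exact: (f'S q cq).2].
    - by rewrite divr_ge0//= ler_pM2r ?invr_gt0// ler_nat.
    - by rewrite divr_gt0//= ler_pdivrMr// mul1r ler_nat.
  exists f'; split=> [q cq|q q' cq cq' dqq'].
    by split; [exact: (f'S q cq).1|exact: f'x].
  have close k : (k <= N.+1)%N -> sphere_dist (g k q) (g k q') < e4.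
    move=> kN; have [hq _] := cq; have [hq' _] := cq'.
    have [vv _] := cap_normalize_segment c0 (tn _ kN) capx cq.
    have [ww _] := cap_normalize_segment c0 (tn _ kN) capx cq'.
    apply: sphere_dist_normalize_lt vv ww _; rewrite ?e40//.
    apply: le_lt_trans (dh q q' hq hq' dqq').
    have -> : segment x.1 q (k%:R / N.+1%:R) - segment x.1 q' (k%:R / N.+1%:R)
        = (k%:R / N.+1%:R) *: (q - q').
      by apply/rowP => i; rewrite !mxE; ring.
    have /andP[t0 t1] := tn _ kN.
    rewrite dot3Zl dot3Zr mulrA ler_piMl ?dot3_ge0//.
    by rewrite mulr_ile1.
  have hg1 : sphere (g n.+1 q) by case: (capg _ _ nN cq).
  have hg2 : sphere (g n.+1 q') by case: (capg _ _ nN cq').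
  have [S1 l1] := f'S q cq; have [S2 l2] := f'S q' cq'.
  have close_f' : `|f' q' - f' q| < e.
    have -> : f' q' - f' q = (f' q' - f q') - (f q - f q') - (f' q - f q) by ring.
    have s1 := step _ cq; have s2 := step _ cq'.
    have s3 := f_lip _ _ cq cq' dqq'; have s4 := close _ (ltnW nN).
    apply: le_lt_trans (ler_normB _ _) _.
    have := ler_normB (f' q' - f q') (f q - f q').
    by rewrite /e4 in s1 s2 s4; lra.
  have [_ [contr uniq]] := inbox _ _ (capg _ _ nN cq) (f'x _ cq) S1.
  (* [contr] compares distinct base points; over a common one [uniq] identifies the two lifts. *)
  have [gg|/eqP ngg] := eqVneq (g n.+1 q') (g n.+1 q).
    have /= := uniq (g n.+1 q', f' q') S2 gg close_f'.
    by case=> _ ->; rewrite subrr normr0 sphere_dist_ge0.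
  rewrite distrC; apply: ltW; apply: (contr (g n.+1 q', f' q')) => //.
  by apply: lt_trans (close _ nN) _; rewrite /e4; lra.
have [f [fS f_lip]] := Hn N.+1 (leqnn _).
have gN q : sphere q -> g N.+1 q = q.
  move=> hq; rewrite /g /segment divff ?gt_eqF// subrr scale0r add0r scale1r.
  exact: normalize_id.
have fSq q : cap c q -> S (q, f q).
  by move=> cq; have [] := fS q cq; rewrite gN//; case: cq.
exists f; split => //.
  have [_] := fS _ capx; rewrite gN// sphere_distxx// normr_le0 subr_eq0.
  by move/eqP.
(* Below [d] the last-stage lifts are close enough for [contr]; strict inequalities then add up
   along midpoints. *)
apply: (cap_midpoint_ind c0 d0).
  move=> p q cp cq dpq npq; have [hp' _] := cp; have [hq _] := cq.
  have [_] := fS p cp; rewrite gN// => fp.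
  have [|_ [contr _]] := eS (p, f p) (fSq _ cp) cp.
    have dpi : sphere_dist x.1 p <= pi by exact: sphere_dist_lepi.
    by rewrite -ler_distl (le_trans fp).
  rewrite distrC; apply: (contr (q, f q)) => //=.
  - exact: fSq.
  - by apply: lt_le_trans dpq _; rewrite ge_min lexx.
  - rewrite distrC; apply: le_lt_trans (f_lip _ _ cp cq dpq) _.
    by rewrite !gN//; apply: lt_le_trans dpq _; rewrite ge_min lexx.
  - by move=> qp; apply: npq.
move=> p m q cp cm cq npq npm nmq <- Ppm Pmq _.
have -> : f p - f q = (f p - f m) + (f m - f q) by ring.
by apply: le_lt_trans (ler_normD _ _) _; rewrite ltrD// ?Ppm// ?Pmq.
Qed.

(** If two sections agree at one end of an arc shorter than [e / 2], their values at the other end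
    differ by less than [e], where [graph_like] allows a single point of the fibre. Midpoint
    induction carries the agreement from [x] to the cap. *)
Lemma cap_section_unique S x c f f' : proper_spacelike_surface S ->
    0 < c -> cap c x.1 ->
  f x.1 = x.2 -> (forall q, cap c q -> S (q, f q)) -> contracting_on (cap c) f ->
  f' x.1 = x.2 -> (forall q, cap c q -> S (q, f' q)) ->
  contracting_on (cap c) f' ->
  forall q, cap c q -> f q = f' q.
Proof.
move=> hS c0 cx fx fS f_c f'x f'S f'_c q cq.
have [e /andP[e0 epi] eS] := uniform_graph_like (x.2 - pi) (x.2 + pi) hS c0.
have lip (k : 'rV[R]_3 -> R) p r : contracting_on (cap c) k ->
    cap c p -> cap c r -> `|k p - k r| <= sphere_dist p r.
  move=> kc cp cr; have [->|/eqP npr] := eqVneq p r.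
    by rewrite subrr normr0 sphere_distxx//; case: cr.
  exact/ltW/kc.
have e20 : 0 < e / 2 by rewrite divr_gt0.
have : f x.1 = f' x.1 -> f q = f' q; last by rewrite fx f'x; apply.
apply: (cap_midpoint_ind (P := fun p q => f p = f' p -> f q = f' q) c0 e20) => //.
- move=> p r cp cr dpr ffp.
  have [|_ [_ uniq]] := eS (r, f' r) (f'S _ cr) cr.
    have dpi : sphere_dist r x.1 <= pi.
      by apply: sphere_dist_lepi; [case: cr|case: cx].
    by rewrite -ler_distl -f'x (le_trans (lip _ _ _ f'_c cr cx)).
  suff /(uniq (r, f r) (fS _ cr) erefl)[] : `|f r - f' r| < e by [].
  have -> : f r - f' r = (f' p - f' r) - (f p - f r) by rewrite ffp; ring.
  have h1 := lip _ _ _ f_c cp cr; have h2 := lip _ _ _ f'_c cp cr.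
  have h3 := ler_normB (f' p - f' r) (f p - f r).
  lra.
- by move=> p m r _ _ _ _ _ _ _ pm mr /pm/mr.
Qed.

End Sections.

(** * Global graph of the surface and its Lipschitz extension *)

Section Graph.
Variable R : realType.
Implicit Types (p q r u v : 'rV[R]_3) (x y : 'rV[R]_3 * R)
  (S : set ('rV[R]_3 * R)).

(** Sections over caps glue, since by uniqueness two of them agree on the smaller cap. *)
Lemma global_section S x : proper_spacelike_surface S -> S x ->
  exists f, [/\ f x.1 = x.2, graph_on (@disk R) f `<=` S &
    contracting_on (@disk R) f].
Proof.
move=> hS Sx; have [hx x0] : disk x.1 by case: hS => /(_ _ Sx)[].
have [f_ f_S] : exists f_ : R -> 'rV[R]_3 -> R,
    forall c, 0 < c -> c <= x.1 0 2 -> [/\ f_ c x.1 = x.2,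
      forall q, cap c q -> S (q, f_ c q) & contracting_on (cap c) (f_ c)].
  have ex c : exists f : 'rV[R]_3 -> R, 0 < c -> c <= x.1 0 2 ->
      [/\ f x.1 = x.2, forall q, cap c q -> S (q, f q) &
      contracting_on (cap c) f].
    have [c0|] := ltP 0 c; last by exists (fun=> 0).
    have [cx|] := leP c (x.1 0 2); last by exists (fun=> 0).
    by have [f hf] := cap_section hS Sx c0 cx; exists f.
  by have [f_ hf_] := choice ex; exists f_.
(* Height of the smallest cap containing both [x.1] and [q]. *)
pose h q := Num.min (x.1 0 2) (q 0 2).
have h0 q : disk q -> 0 < h q by move=> [_ q0]; rewrite lt_min x0.
have hx' q : h q <= x.1 0 2 by rewrite ge_min lexx.
have caph q : disk q -> cap (h q) q by move=> [hq _]; rewrite /cap/= ge_min lexx orbT.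
pose F q := f_ (h q) q.
have FE c q : 0 < c -> c <= h q -> disk q -> F q = f_ c q.
  move=> c0 ch Dq; have cx := le_trans ch (hx' q).
  have [f1 f2 f3] := f_S _ c0 cx; have [g1 g2 g3] := f_S _ (h0 _ Dq) (hx' q).
  have sub r : cap (h q) r -> cap c r.
    by move=> [hr qr]; split => //; exact: le_trans qr.
  apply: (cap_section_unique hS (h0 _ Dq) _ g1 g2 g3 f1) => //.
  - by move=> r /sub; exact: f2.
  - by move=> r s /sub hr /sub hs; exact: f3.
  - exact: caph.
exists F; split.
- have hxx : h x.1 <= x.1 0 2 by exact: hx'.
  by have [] := f_S _ (h0 x.1 (conj hx x0)) hxx.
- move=> [q t] [/= Dq ->]; have [_ + _] := f_S _ (h0 _ Dq) (hx' q).
  by apply; exact: caph.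
(* On a cap holding [x.1], [p] and [q], a single contracting section gives both values of [F]. *)
- move=> p q Dp Dq npq; pose c := Num.min (h p) (h q).
  have c0 : 0 < c by rewrite lt_min !h0.
  have cp : c <= h p by rewrite ge_min lexx.
  have cq : c <= h q by rewrite ge_min lexx orbT.
  have [_ _ contr] := f_S c c0 (le_trans cp (hx' p)).
  rewrite (FE c p)// (FE c q)//; apply: contr => //.
  + by split; [case: Dp|apply: le_trans cp _; case: (caph _ Dp)].
  + by split; [case: Dq|apply: le_trans cq _; case: (caph _ Dq)].
Qed.

Lemma nbhs_contracting_on_disk f q e : contracting_on (@disk R) f -> disk q ->
  0 < e -> \forall r \near q, disk r -> `|f q - f r| < e.
Proof.
move=> fc Dq e0; have hq : sphere q by case: Dq.
apply: filterS (nbhs_sphere_dist_lt hq e0) => r hr Dr.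
have dr : sphere_dist q r < e by apply: hr; case: Dr.
have [<-|/eqP nqr] := eqVneq q r; first by rewrite subrr normr0.
by apply: lt_trans dr; exact: fc.
Qed.

(** The graph of a global section is open and closed in the connected set [S]. *)
Lemma surface_eq_graph S : proper_spacelike_surface S ->
  exists2 f, S = graph_on (@disk R) f & contracting_on (@disk R) f.
Proof.
move=> hS; have [SD [x Sx] connS _ loc] := hS.
have DS y : S y -> disk y.1 by move=> /SD[].
have [f [fx fS fc]] := global_section hS Sx.
exists f => //; apply/esym/connS.
- by exists x; split => //; exact: DS.
(* Open: near [y] the graph of [f] runs inside the chart neighbourhood [W], where [S] has one point
   per fibre. *)
- exists (interior [set y | S y -> graph_on (@disk R) f y]).
    exact: open_interior.
  apply/seteqP; split=> [y Gy|y [Sy /interior_subset]]; last exact.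
  have Sy := fS _ Gy; split => //; have [Dy yf] := Gy.
  have [W [U [g [oW Wy oU _ SW]]]] := loc y Sy.
  have nW : nbhs y W by exact: open_nbhs_nbhs.
  have : \forall r \near y.1, disk r -> W (r, f r).
    have [/= e e0 eW] : nbhs_ball y W by apply/nbhs_ballP.
    have := nbhsx_ballx y.1 e e0.
    have := nbhs_contracting_on_disk fc Dy e0.
    apply: filterS2 => r fr br Dr; apply: eW; split => //=.
    by rewrite yf; exact: fr.
  move=> /(@cvg_fst _ _ (nbhs y.1) (nbhs y.2)) nf.
  apply: filterS2 nW nf => z Wz /= fz Sz.
  have Dz := DS _ Sz; split => //.
  have : (S `&` W) z by []. rewrite SW => -[_ ->].
  have : (S `&` W) (z.1, f z.1) by split; [exact: fS|exact: fz].
  by rewrite SW => -[].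
(* Closed: [f] is continuous on the disk, so a limit of graph points over the disk is a graph
   point. *)
- exists (closure (graph_on (@disk R) f)); first exact: closed_closure.
  apply/seteqP; split=> [y Gy|y [Sy cly]].
    by split; [exact: fS|exact: subset_closure].
  have Dy := DS _ Sy; split => //; apply/eqP; rewrite -subr_eq0 -normr_eq0.
  apply/eqP/le_anti; rewrite normr_ge0 andbT; apply/ler_addgt0Pl => e e0.
  rewrite addr0; have e20 : 0 < e / 2 by rewrite divr_gt0.
  have n1 : \forall z \near y, disk z.1 -> `|f y.1 - f z.1| < e / 2.
    exact: (@cvg_fst _ _ (nbhs y.1) (nbhs y.2)) (nbhs_contracting_on_disk fc Dy e20).
  have n2 : \forall z \near y, `|y.2 - z.2| < e / 2.
    exact: (@cvg_snd _ _ (nbhs y.1) (nbhs y.2)) (nbhsx_ballx y.2 _ e20).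
  have [z [[Dz zf] [h1 h2]]] := cly _ (filterI n1 n2).
  have -> : y.2 - f y.1 = (y.2 - z.2) - (f y.1 - f z.1) by rewrite zf; ring.
  apply: le_trans (ler_normB _ _) _; have := h1 Dz; move: h2 => /=; lra.
Qed.

(** McShane extension: the infimum of [f p + sphere_dist p q] over [p] in the disk, which the
    triangle inequality makes 1-Lipschitz in [q]. *)
Lemma lipschitz_extension f : @disk R !=set0 -> contracting_on (@disk R) f ->
  exists g, (forall p, disk p -> g p = f p) /\
    forall p q, sphere p -> sphere q -> `|g p - g q| <= sphere_dist p q.
Proof.
case=> o Do fc.
have ho : sphere o by case: Do.
have flip p q : disk p -> disk q -> f p - f q <= sphere_dist p q.
  move=> Dp Dq; apply: le_trans (ler_norm _) _.
  have [->|/eqP npq] := eqVneq p q; last exact/ltW/fc.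
  by rewrite subrr normr0 sphere_distxx//; case: Dq.
pose E q := [set f p + sphere_dist p q | p in @disk R].
have lbE q : sphere q -> lbound (E q) (f o - sphere_dist q o).
  move=> hq _ [p Dp <-]; have hp : sphere p by case: Dp.
  have := flip _ _ Do Dp; have := sphere_dist_triangle ho hq hp.
  by rewrite (sphere_distC o q) (sphere_distC q p); lra.
have infE q : sphere q -> has_inf (E q).
  move=> hq; split; first by exists (f o + sphere_dist o q), o.
  by exists (f o - sphere_dist q o); exact: lbE.
have le_inf p q : sphere p -> sphere q -> inf (E p) - inf (E q) <= sphere_dist p q.
  move=> hp hq; rewrite lerBlDr addrC -lerBlDr.
  apply: lb_le_inf; first by case: (infE q hq).
  move=> _ [r Dr <-]; have hr : sphere r by case: Dr.
  rewrite lerBlDr; apply: le_trans (_ : f r + sphere_dist r p <= _).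
    by apply: ge_inf; [case: (infE p hp)|exists r].
  have := sphere_dist_triangle hr hq hp; rewrite (sphere_distC q p); lra.
exists (fun q => inf (E q)); split=> [p Dp|p q hp hq].
  have hp : sphere p by case: Dp.
  apply/le_anti/andP; split.
    apply: ge_inf; first by case: (infE p hp).
    by exists p => //; rewrite sphere_distxx// addr0.
  apply: lb_le_inf; first by case: (infE p hp).
  move=> _ [q Dq <-]; have := flip _ _ Dp Dq.
  by rewrite (sphere_distC p q); lra.
rewrite ler_norml lerNl opprB le_inf// andbT.
by rewrite sphere_distC le_inf.
Qed.

End Graph.

(** * Causal curves and the Cauchy development *)

Section Curves.
Variable R : realType.
Implicit Types (p q r u v : 'rV[R]_3) (x y : 'rV[R]_3 * R)
  (S : set ('rV[R]_3 * R)) (f : 'rV[R]_3 -> R) (c : R -> 'rV[R]_3 * R).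

(** Allows each causal argument to be carried out on one side of the surface only. *)
Definition time_reversal x : 'rV[R]_3 * R := (x.1, - x.2).

Lemma time_reversalK : involutive time_reversal.
Proof. by case=> p t; rewrite /time_reversal/= opprK. Qed.

Lemma cvg_time_reversal (T : Type) (F : set_system T) {FF : Filter F}
    (c : T -> 'rV[R]_3 * R) y :
  c @ F --> y -> time_reversal (c s) @[s --> F] --> time_reversal y.
Proof.
move=> cy.
have c1 : (c s).1 @[s --> F] --> y.1.
  exact: cvg_comp cy (@cvg_fst _ _ (nbhs y.1) (nbhs y.2) _).
have c2 : (c s).2 @[s --> F] --> y.2.
  exact: cvg_comp cy (@cvg_snd _ _ (nbhs y.1) (nbhs y.2) _).
exact: cvg_pair c1 (cvgN c2).
Qed.

(** The parameter is reversed as well, so that time still increases; the two ends are exchanged. *)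
Lemma inextensible_causal_curve_reversal c : inextensible_causal_curve c ->
  inextensible_causal_curve (fun s => time_reversal (c (- s))).
Proof.
have revK : (fun s => time_reversal (time_reversal (c (- s)))) = c \o -%R.
  by apply/funext => s /=; exact: time_reversalK.
case=> cc cD caus fut past; split.
- move=> s; have cs : c (- t) @[t --> s] --> c (- s).
    apply: (@cvg_comp _ _ _ -%R c _ (nbhs (- s))); last exact: cc.
    exact: (cvgN (@cvg_id _ (nbhs s))).
  exact: cvg_time_reversal cs.
- by move=> s; have [] := cD (- s).
- move=> s t st; have [|lt d] := caus (- t) (- s); first by rewrite ltrN2.
  rewrite /= ltrN2; split => //; rewrite sphere_distC.
  by apply: le_trans d _; rewrite opprK addrC.
- move=> [y Dy cy]; apply: past; exists (time_reversal y) => //.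
  apply/num_normedtype.cvgNy_compNP.
  by have := cvg_time_reversal cy; rewrite revK; apply.
- move=> [y Dy cy]; apply: fut; exists (time_reversal y) => //.
  apply/num_normedtype.cvgy_compNP.
  by have := cvg_time_reversal cy; rewrite revK; apply.
Qed.

Lemma Cauchy_development_reversal S x : Cauchy_development S x ->
  Cauchy_development (time_reversal @` S) (time_reversal x).
Proof.
move=> [Dx hx]; split => // c hc [s0 _ cs0].
have [|s Ss] := hx _ (inextensible_causal_curve_reversal hc).
  by exists (- s0) => //; rewrite opprK cs0 time_reversalK.
exists (- s); exists (time_reversal (c (- s))) => //.
exact: time_reversalK.
Qed.

Lemma graph_time_reversal (V : set 'rV[R]_3) f :
  time_reversal @` graph_on V f = graph_on V (fun p => - f p).
Proof.
apply/seteqP; split=> [_ [x [Vx xf] <-]|x [Vx xf]].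
  by split => //=; rewrite xf.
by exists (time_reversal x); [split => //=; rewrite xf opprK|exact: time_reversalK].
Qed.

Lemma contracting_onN V f : contracting_on V f -> contracting_on V (fun p => - f p).
Proof. by move=> fc p q Vp Vq /(fc p q Vp Vq); rewrite -opprB normrN opprK addrC. Qed.

Lemma lipschitz1_onN V f : lipschitz1_on V f -> lipschitz1_on V (fun p => - f p).
Proof. by move=> fc p q Vp Vq; rewrite -normrN opprB opprK addrC; exact: fc. Qed.

Lemma cvg_rV3 (T : Type) (F : set_system T) {FF : Filter F}
    (f : T -> 'rV[R]_3) p :
  (forall i, f s 0 i @[s --> F] --> p 0 i) -> f @ F --> p.
Proof.
move=> fp; apply/cvg_ballP => e e0.
have : \forall s \near F, forall i, ball (p 0 i) e (f s 0 i).
  by apply: filter_forall => i; move: (fp i) => /cvg_ballP; apply.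
by apply: filterS => s h; split => // i j; rewrite ord1.
Qed.

Lemma causal_curve_le c s t : inextensible_causal_curve c -> s <= t ->
  sphere_dist (c s).1 (c t).1 <= (c t).2 - (c s).2.
Proof.
case=> _ cD caus _ _; rewrite le_eqVlt => /predU1P[<-|/caus[]//].
by rewrite subrr sphere_distxx//; have [[]] := cD s.
Qed.

(* Otherwise the curve stays below the graph, hence its time is bounded; since
   it is Lipschitz in its time, it has an end point, which must lie over the
   circle, not above the graph of [f]. *)
Lemma causal_curve_future_meets f c s0 : contracting_on (@disk R) f ->
  lipschitz1_on (@closed_disk R) f -> inextensible_causal_curve c ->
  (forall xi, circle xi -> f xi - (c s0).2 < sphere_dist (c s0).1 xi) ->
  exists2 s, s0 <= s & f (c s).1 <= (c s).2.
Proof.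
move=> fc flip hc below; have [cc cD caus fut _] := hc.
have hS s : sphere (c s).1 by case: (cD s) => -[].
have Dc s : closed_disk (c s).1 by case: (cD s) => -[? /ltW].
apply: contrapT => nmeet.
have under s : s0 <= s -> (c s).2 < f (c s).1.
  by move=> s0s; rewrite ltNge; apply/negP => h; apply: nmeet; exists s.
have dist_le s t : s <= t -> sphere_dist (c s).1 (c t).1 <= (c t).2 - (c s).2.
  exact: causal_curve_le.
have incr s t : s <= t -> (c s).2 <= (c t).2.
  move=> /dist_le; have := sphere_dist_ge0 (hS s) (hS t); lra.
(* Time bound below the graph: [f] is 1-Lipschitz and distances are at most [pi]. *)
pose M := f (c s0).1 + pi.
have ubM s : (c s).2 <= M.
  have [s0s|/ltW ss0] := leP s0 s.
    have := under s s0s; have := flip _ _ (Dc s) (Dc s0).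
    have := ler_norm (f (c s).1 - f (c s0).1).
    have := sphere_dist_lepi (hS s) (hS s0); rewrite /M; lra.
  have := incr _ _ ss0; have := under s0 (lexx _); have := @pi_ge0 R.
  rewrite /M; lra.
have cvgt : (c s).2 @[s --> +oo] --> sup (range (fun s => (c s).2)).
  apply: nondecreasing_cvgr => //.
  by exists M => _ [s _ <-].
set th := sup _ in cvgt.
(* A coordinate varies no faster than the time, so its sum with the time is nondecreasing and
   bounded. *)
have cvgp i : exists l : R, (c s).1 0 i @[s --> +oo] --> l.
  have h : (c s).1 0 i + (c s).2 @[s --> +oo] -->
      sup (range (fun s => (c s).1 0 i + (c s).2)).
    apply: nondecreasing_cvgr => [s t st|].
      have := dist_le s t st.
      have := coord_le_sphere_dist i (hS s) (hS t).
      have := ler_norm ((c s).1 0 i - (c t).1 0 i); lra.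
    exists (1 + M) => _ [s _ <-]; apply: lerD => //.
    apply: le_trans (ler_norm _) _; rewrite -(expr_le1 (_ : 0 < 2)%N)//.
    by rewrite real_normK ?num_real// -(hS s) sqr_coord_le_dot3.
  exists (sup (range (fun s => (c s).1 0 i + (c s).2)) - th).
  have -> : (fun s => (c s).1 0 i) = (fun s => (c s).1 0 i + (c s).2 - (c s).2).
    by apply/funext => s; rewrite addrK.
  exact: cvgB h cvgt.
have [l cvgl] := choice cvgp.
pose p := \row_i l i : 'rV[R]_3.
have cvgc1 : (c s).1 @[s --> +oo] --> p.
  by apply: cvg_rV3 => i; rewrite mxE; exact: cvgl.
have cvgc : c s @[s --> +oo] --> (p, th).
  have cE : (fun s => ((c s).1, (c s).2)) = c by apply/funext => s; case: (c s).
  by have := cvg_pair cvgc1 cvgt; rewrite cE; exact.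
have hp : sphere p.
  have h : dot3 (c s).1 (c s).1 @[s --> +oo] --> dot3 p p by exact: cvg_dot3.
  have h1 : dot3 (c s).1 (c s).1 @[s --> +oo] --> (1 : R).
    by under eq_fun do rewrite hS; exact: cvg_cst.
  exact: (cvg_unique (@Rhausdorff R) h h1).
have p20 : 0 <= p 0 2.
  rewrite mxE; apply: cvgr_to_ge (cvgl 2) _.
  by near=> s; case: (cD s) => -[_ /ltW].
(* A limit over the open disk would be a future end point. *)
have p2 : p 0 2 = 0.
  apply/eqP; rewrite eq_le p20 andbT leNgt; apply/negP => p2_gt0.
  by apply: fut; exists (p, th).
have Dp : closed_disk p by split => //; rewrite p2.
have near_p e : 0 < e -> \forall s \near +oo, sphere_dist p (c s).1 < e.
  move=> e0.
  have n : \forall s \near +oo, sphere (c s).1 -> sphere_dist p (c s).1 < e.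
    exact: cvgc1 (nbhs_sphere_dist_lt hp e0).
  by near=> s; have := hS s; near: s.
(* In the limit [(p, f p)] would lie in the causal future of [c s0], against [below]. *)
suff : sphere_dist (c s0).1 p <= f p - (c s0).2.
  by rewrite leNgt below.
apply/ler_addgt0Pl => e e0.
have e20 : 0 < e / 2 by rewrite divr_gt0.
have [s [s0s dps]] : exists s, s0 <= s /\ sphere_dist p (c s).1 < e / 2.
  near (pinfty_nbhs R) => s; exists s; split.
    by near: s; apply: nbhs_pinfty_ge; exact: num_real.
  by near: s; exact: near_p.
have := sphere_dist_triangle (hS s0) (hS s) hp.
have := dist_le _ _ s0s; have := under _ s0s.
have := flip _ _ Dp (Dc s); rewrite (sphere_distC (c s).1 p).
have := ler_norm (f (c s).1 - f p); rewrite distrC; lra.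
Unshelve. all: by end_near. Qed.

(** The curve is on or above the graph at a later parameter and, by time reversal, on or below it at
    an earlier one; the intermediate value theorem gives a crossing. *)
Lemma Cauchy_development_of_lt f x : contracting_on (@disk R) f ->
  lipschitz1_on (@closed_disk R) f -> disk x.1 ->
  (forall xi, circle xi -> `|x.2 - f xi| < sphere_dist x.1 xi) ->
  Cauchy_development (graph_on (@disk R) f) x.
Proof.
move=> fc flip Dx hx; split => // c hc [s0 _ cs0].
have [cc cD _ _ _] := hc.
have [s1 s01 h1] : exists2 s, s0 <= s & f (c s).1 <= (c s).2.
  apply: causal_curve_future_meets => // xi /hx; rewrite cs0.
  by rewrite distrC; apply: le_lt_trans; exact: ler_norm.
have [s2 s20 h2] : exists2 s, s <= s0 & (c s).2 <= f (c s).1.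
  have [|s ss0 h] := @causal_curve_future_meets (fun p => - f p) _ (- s0)
    (contracting_onN fc) (lipschitz1_onN flip)
    (inextensible_causal_curve_reversal hc).
    move=> xi /hx; rewrite /= (opprK s0) cs0 opprK addrC.
    by apply: le_lt_trans; exact: ler_norm.
  by exists (- s); [rewrite lerNl|rewrite -lerN2].
pose g s := (c s).2 - f (c s).1.
have g_cont : continuous g.
  move=> s; apply: cvgB.
    by apply: cvg_comp (cc s) _; exact: (@cvg_snd _ _ (nbhs (c s).1) (nbhs (c s).2)).
  apply/cvgrPdist_lt => e e0.
  have Dcs : disk (c s).1 by case: (cD s).
  have n : \forall t \near s, disk (c t).1 -> `|f (c s).1 - f (c t).1| < e.
    have n : \forall y \near c s, disk y.1 -> `|f (c s).1 - f y.1| < e.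
      exact: (@cvg_fst _ _ (nbhs (c s).1) (nbhs (c s).2))
        (nbhs_contracting_on_disk fc Dcs e0).
    exact: cc n.
  by near=> t; have [+ _] := cD t; near: t.
have [||s _ gs] := @IVT R g s2 s1 0 (le_trans s20 s01).
- exact: continuous_subspaceT.
- rewrite ge_min le_max; apply/andP; split; apply/orP.
    by left; rewrite subr_le0.
  by right; rewrite subr_ge0.
exists s; split; first by case: (cD s).
by apply/eqP; rewrite -subr_eq0; apply/eqP.
Unshelve. all: by end_near. Qed.

End Curves.

(** * Null geodesics reaching the boundary *)

Section CausalBoundary.
Variable R : realType.
Implicit Types (p q r u v : 'rV[R]_3) (x y : 'rV[R]_3 * R)
  (S : set ('rV[R]_3 * R)) (f : 'rV[R]_3 -> R) (c : R -> 'rV[R]_3 * R).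

(** At distance 0 or [pi] the points would be equal or antipodal, forcing [p] to height 0. The sine
    of the distance is thus positive, as divisions in [geodesic] require. *)
Lemma disk_circle_dist p q : disk p -> circle q -> 0 < sphere_dist p q < pi.
Proof.
move=> [hp p0] [hq q0]; apply/andP; split.
  by apply: sphere_dist_gt0 => // pq; move: p0; rewrite pq q0 ltxx.
rewrite lt_neqAle sphere_dist_lepi// andbT; apply/eqP => dpi.
have pq : p + q = 0.
  apply: dot3_eq0; rewrite !dot3_linear (dot3C q p) hp hq.
  by rewrite -cos_sphere_dist// dpi cospi; ring.
by move/rowP/(_ 2) : pq; rewrite !mxE q0 addr0 => p20; rewrite p20 ltxx in p0.
Qed.

(** The extension is only 1-Lipschitz at the circle; strictness comes from the half arc from [q] to
    the midpoint, which lies in the open disk. *)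
Lemma contracting_to_circle f q xi : contracting_on (@disk R) f ->
  lipschitz1_on (@closed_disk R) f -> disk q -> circle xi ->
  `|f q - f xi| < sphere_dist q xi.
Proof.
move=> fc flip Dq Cx.
have /andP[d0 _] := disk_circle_dist Dq Cx.
have [hq q0] := Dq; have [hx x0] := Cx.
have [|m [hm dqm dmx m0 _]] := sphere_midpoint hq hx q0; first by rewrite x0.
have Dm : closed_disk m by split=> //; exact: ltW.
have Dx : closed_disk xi by split=> //; rewrite x0.
have -> : f q - f xi = (f q - f m) + (f m - f xi) by ring.
apply: le_lt_trans (ler_normD _ _) _.
have -> : sphere_dist q xi = sphere_dist q m + sphere_dist m xi.
  by rewrite dqm dmx; field.
apply: ltr_leD; last exact: flip.
by apply: fc => // qm; move: dqm; rewrite -qm sphere_distxx//; lra.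
Qed.

(** Spherical linear interpolation: the unit-speed great circle from [p] at 0 to [q] at
    [sphere_dist p q]. *)
Definition geodesic p q (a : R) : 'rV[R]_3 :=
  (sin (sphere_dist p q - a) / sin (sphere_dist p q)) *: p +
  (sin a / sin (sphere_dist p q)) *: q.

Lemma dot3_geodesic p q a b : sphere p -> sphere q ->
  0 < sphere_dist p q < pi ->
  dot3 (geodesic p q a) (geodesic p q b) = cos (a - b).
Proof.
move=> hp hq d0; have s0 := sin_gt0_pi d0.
rewrite /geodesic !dot3_linear (dot3C q p) hp hq -(cos_sphere_dist hp hq).
rewrite !sinB cosB.
have := cos2Dsin2 (sphere_dist p q); move: (cos _) (sin _) s0 => C T T0 CT.
have T2 : C ^+ 2 = 1 - T ^+ 2 by rewrite -CT; ring.
apply: (mulfI (lt0r_neq0 (exprn_gt0 2 T0))).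
(* Expanding the left side leaves [T ^+ 2] before the cosines but [1 - C ^+ 2] before the sines. *)
have -> : T ^+ 2 * (cos a * cos b + sin a * sin b) =
  T ^+ 2 * (cos a * cos b) + (1 - C ^+ 2) * (sin a * sin b).
  by rewrite T2; ring.
field.
by rewrite gt_eqF.
Qed.

(* If [x] is in the causal future of [(xi, f xi)], the past-directed null
   geodesic from [x] to the boundary followed from [x] on by a vertical
   half-line stays strictly above the graph of [f]. *)
Lemma Cauchy_development_lt_above f x xi : contracting_on (@disk R) f ->
  lipschitz1_on (@closed_disk R) f ->
  Cauchy_development (graph_on (@disk R) f) x -> circle xi ->
  x.2 - f xi < sphere_dist x.1 xi.
Proof.
move=> fc flip [[Dx _] hx] Cxi; rewrite ltNge; apply/negP => above.
have /andP[d0 dpi] := disk_circle_dist Dx Cxi.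
have [hp p0] := Dx; have [hxi xi0] := Cxi.
have dotg a b : dot3 (geodesic x.1 xi a) (geodesic x.1 xi b) = cos (a - b).
  by apply: dot3_geodesic => //; rewrite d0.
have g0 : geodesic x.1 xi 0 = x.1.
  rewrite /geodesic subr0 sin0 mul0r scale0r addr0 divff ?scale1r//.
  by rewrite gt_eqF// sin_gt0_pi// d0.
have gd : geodesic x.1 xi (sphere_dist x.1 xi) = xi.
  rewrite /geodesic subrr sin0 mul0r scale0r add0r divff ?scale1r//.
  by rewrite gt_eqF// sin_gt0_pi// d0.
have g2 a : geodesic x.1 xi a 0 2 =
    sin (sphere_dist x.1 xi - a) / sin (sphere_dist x.1 xi) * x.1 0 2.
  by rewrite !mxE xi0 mulr0 addr0.
have g_cont : continuous (geodesic x.1 xi).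
  move=> a; apply: cvgD; apply: cvgZr_tmp; apply: cvgM; try exact: cvg_cst.
    have da : sphere_dist x.1 xi - b @[b --> a] --> sphere_dist x.1 xi - a.
      by apply: cvgB; [exact: cvg_cst|exact: cvg_id].
    exact: cvg_comp da (@continuous_sin R _).
  exact: continuous_sin.
move: (sphere_dist x.1 xi) (geodesic x.1 xi) g_cont d0 dpi above dotg g0 gd g2.
move=> D g g_cont D0 Dpi above dotg g0 gd g2.
have hg a : sphere (g a) by rewrite /sphere/= dotg subrr cos0.
have distg a b : 0 <= a <= D -> 0 <= b <= D -> sphere_dist (g a) (g b) = `|a - b|.
  move=> /andP[a0 aD] /andP[b0 bD]; apply: sphere_dist_eqE => //.
    rewrite normr_ge0/= (le_trans _ (ltW Dpi))// ler_norml; apply/andP; split; lra.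
  by rewrite cos_norm dotg.
(* Visibly continuous forms of the minimum and the maximum of [s] and 0. *)
pose neg s : R := (s - `|s|) / 2; pose pos s : R := (s + `|s|) / 2.
have negE s : s <= 0 -> neg s = s by move=> s0; rewrite /neg ler0_norm//; field.
have pos0 s : s <= 0 -> pos s = 0 by move=> s0; rewrite /pos ler0_norm//; field.
have neg0 s : 0 <= s -> neg s = 0 by move=> s0; rewrite /neg ger0_norm//; field.
have posE s : 0 <= s -> pos s = s by move=> s0; rewrite /pos ger0_norm//; field.
(* Arc length from [x.1]: it tends to [D] without reaching it as [s] goes to minus infinity, and is
   0 from [s = 0] on, where [c] is vertical. *)
pose al s := D * (1 - expR (neg s)).
have al_ge0 s : 0 <= al s.
  rewrite /al mulr_ge0 ?(ltW D0)// subr_ge0 -expR0 ler_expR.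
  by have [s0|/ltW s0] := leP 0 s; [rewrite neg0|rewrite negE].
have al_lt s : al s < D.
  by rewrite /al gtr_pMr// ltrBlDr ltrDl expR_gt0.
pose c s : 'rV[R]_3 * R := (g (al s), x.2 - al s + pos s).
have cont_norm (s : R) : `|t| @[t --> s] --> `|s|.
  by apply: cvg_norm; exact: cvg_id.
have al_cont : continuous al.
  move=> s; apply: cvgM; first exact: cvg_cst.
  apply: cvgB; first exact: cvg_cst.
  have neg_cont : neg t @[t --> s] --> neg s.
    by apply: cvgM; [apply: cvgB; [exact: cvg_id|exact: cont_norm]|exact: cvg_cst].
  exact: cvg_comp neg_cont (@continuous_expR R _).
have c_cont : continuous c.
  move=> s; have c1 : g (al t) @[t --> s] --> g (al s).
    exact: cvg_comp (al_cont s) (g_cont _).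
  have c2 : x.2 - al t + pos t @[t --> s] --> x.2 - al s + pos s.
    apply: cvgD; first by apply: cvgB; [exact: cvg_cst|exact: al_cont].
    by apply: cvgM; [apply: cvgD; [exact: cvg_id|exact: cont_norm]|exact: cvg_cst].
  exact: cvg_pair c1 c2.
have Dg s : disk (g (al s)).
  split; first exact: hg.
  rewrite g2 mulr_gt0// divr_gt0// sin_gt0_pi ?D0//.
  have := al_ge0 s; have := al_lt s => h1 h2; apply/andP; split; lra.
have al_range s : 0 <= al s <= D by rewrite al_ge0 ltW.
have distgD s : sphere_dist (g (al s)) (g D) = D - al s.
  by rewrite distg ?al_range ?lexx ?(ltW D0)// distrC ger0_norm// subr_ge0 ltW.
have mono s t : s < t ->
    al t <= al s /\ pos s <= pos t /\ (al t < al s \/ pos s < pos t).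
  move=> st; have [s0|s0] := leP 0 s.
    have t0 := le_trans s0 (ltW st).
    rewrite /al (neg0 _ s0) (neg0 _ t0) (posE _ s0) (posE _ t0).
    by rewrite lexx (ltW st); do 2 split => //; right.
  have [t0|t0] := leP 0 t.
    rewrite /al (neg0 _ t0) (negE _ (ltW s0)) (pos0 _ (ltW s0)) (posE _ t0).
    have e1 : expR s < 1 by rewrite -expR0 ltr_expR.
    have e2 : 0 < D * (1 - expR s) by rewrite mulr_gt0// subr_gt0.
    by rewrite expR0 subrr mulr0; split; [exact: ltW|split => //; left].
  rewrite /al (negE _ (ltW t0)) (negE _ (ltW s0)) (pos0 _ (ltW s0)) (pos0 _ (ltW t0)).
  have e1 : expR s < expR t by rewrite ltr_expR.
  have e2 : D * (1 - expR t) < D * (1 - expR s) by rewrite ltr_pM2l//; lra.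
  by split; [exact: ltW|split => //; left].
have hc : inextensible_causal_curve c.
  split => //.
  - by move=> s; split; first exact: Dg.
  (* The elapsed time is the distance run plus the increase of [pos]. *)
  - move=> s t /mono [h1 [h2 h3]] /=; split; first by case: h3; lra.
    by rewrite distg// ger0_norm; lra.
  (* No future end point: the time is unbounded. *)
  - move=> [y _ cy].
    have c2 : (c s).2 @[s --> +oo] --> y.2.
      exact: cvg_comp cy (@cvg_snd _ _ (nbhs y.1) (nbhs y.2) _).
    have n1 : \forall s \near +oo, (c s).2 < y.2 + 1.
      by apply: (cvgr_lt _ c2); rewrite ltrDl.
    have [s [s0 s1 s2]] : exists s,
        [/\ 0 <= s, y.2 + 1 - x.2 <= s & (c s).2 < y.2 + 1].
      near (pinfty_nbhs R) => s; exists s; split.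
      + by near: s; apply: nbhs_pinfty_ge; exact: num_real.
      + by near: s; apply: nbhs_pinfty_ge; exact: num_real.
      + by near: s.
    move: s2; rewrite /= (posE _ s0) /al (neg0 _ s0) expR0 subrr mulr0; lra.
  (* No past end point: the height tends to 0, its value at [xi], and is positive over the disk. *)
  - move=> [y [[_ y2] _] cy].
    have c1 : (c s).1 @[s --> -oo] --> y.1.
      exact: cvg_comp cy (@cvg_fst _ _ (nbhs y.1) (nbhs y.2) _).
    have n1 : \forall s \near -oo, y.1 0 2 / 2 < (c s).1 0 2.
      have h : y.1 0 2 / 2 < y.1 0 2 by rewrite ltr_pdivrMr//; lra.
      exact: c1 (nbhs_coord_gt h).
    have e0 : 0 < y.1 0 2 / 2 / D by rewrite !divr_gt0.
    have [s [s0 s1 s2]] : exists s : R,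
        [/\ s <= 0, s <= ln (y.1 0 2 / 2 / D) & y.1 0 2 / 2 < (c s).1 0 2].
      near (ninfty_nbhs R) => s; exists s; split.
      + by near: s; apply: nbhs_ninfty_le; exact: num_real.
      + by near: s; apply: nbhs_ninfty_le; exact: num_real.
      + by near: s.
    have : `|g (al s) 0 2 - g D 0 2| <= sphere_dist (g (al s)) (g D).
      by apply: coord_le_sphere_dist.
    rewrite distgD gd xi0 subr0 ger0_norm; last by rewrite /= in s2; lra.
    have : D * expR s <= y.1 0 2 / 2.
      rewrite mulrC -ler_pdivlMr// -[leRHS]lnK ?posrE// ler_expR//.
    by rewrite /al (negE _ s0); move: s2 => /=; rewrite /al (negE _ s0); lra.
have [|s [/= _ cs]] := hx c hc.
  exists 0 => //; rewrite /c /al neg0// expR0 subrr mulr0 g0 subr0.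
  by rewrite pos0// addr0; case: (x).
(* The time of [c s] is at least [f xi + D - al s], and [f] is strictly below this value there. *)
have := contracting_to_circle fc flip (Dg s) Cxi.
rewrite -{2}gd distgD.
have := ler_norm (f (g (al s)) - f xi).
have : 0 <= pos s by have [s0|/ltW s0] := leP 0 s; [rewrite posE|rewrite pos0].
move: cs => /=; lra.
Unshelve. all: by end_near. Qed.

End CausalBoundary.

(** * The invisible domain *)

Section InvisibleDomain.
Variable R : realType.
Implicit Types (p q xi : 'rV[R]_3) (v w : 'rV[R]_4) (x y : 'rV[R]_3 * R)
  (S : set ('rV[R]_3 * R)) (f : 'rV[R]_3 -> R).

Lemma Cauchy_development_lt f x xi : contracting_on (@disk R) f ->
  lipschitz1_on (@closed_disk R) f ->
  Cauchy_development (graph_on (@disk R) f) x -> circle xi ->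
  `|x.2 - f xi| < sphere_dist x.1 xi.
Proof.
move=> fc flip Cx Cxi; have := Cauchy_development_lt_above fc flip Cx Cxi.
have := Cauchy_development_reversal Cx; rewrite graph_time_reversal.
move=> /(Cauchy_development_lt_above (contracting_onN fc) (lipschitz1_onN flip)).
by move=> /(_ _ Cxi) /= h1 h2; rewrite ltr_norml; apply/andP; split; lra.
Qed.

Definition ray_gen x : 'rV[R]_4 :=
  \row_(i < 4) [:: cos x.2; sin x.2; x.1 0 0; x.1 0 1]`_i.

Lemma ray_genE x : [/\ ray_gen x 0 0 = cos x.2, ray_gen x 0 1 = sin x.2,
  ray_gen x 0 2 = x.1 0 0 & ray_gen x 0 3 = x.1 0 1].
Proof. by rewrite !mxE. Qed.

(** As [y.1] has height 0, the space terms of the form make up all of [dot3]; the time terms are a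
    cosine of a difference. *)
Lemma ads_form_ray_gen x y : circle y.1 ->
  ads_form (ray_gen x) (ray_gen y) = dot3 x.1 y.1 - cos (x.2 - y.2).
Proof.
move=> [_ y0]; rewrite /ads_form; have [-> -> -> ->] := ray_genE x.
have [-> -> -> ->] := ray_genE y; rewrite dot3E cosB y0; ring.
Qed.

Lemma ads_formZl (a : R) v w : ads_form (a *: v) w = a * ads_form v w.
Proof. by rewrite /ads_form !mxE; ring. Qed.

Lemma ads_formZr (a : R) v w : ads_form v (a *: w) = a * ads_form v w.
Proof. by rewrite /ads_form !mxE; ring. Qed.

Lemma ray_refl v : ray v v.
Proof. by exists 1; rewrite /= ?ltr01// scale1r. Qed.

Lemma rayZ (a : R) v : 0 < a -> ray (a *: v) = ray v.
Proof.
move=> a0; apply/seteqP; split=> [_ [b /= b0 <-]|_ [b /= b0 <-]].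
  by exists (b * a); rewrite /= ?mulr_gt0// scalerA.
by exists (b / a); rewrite /= ?divr_gt0// scalerA divfK// gt_eqF.
Qed.

(** The cosine inequality places [a] within [d] of 0 modulo [pi *+ 2]; the bound on [a] excludes the
    other multiples. *)
Lemma cos_gt_dist (a d : R) : 0 <= d <= pi -> `|a| < pi *+ 2 - d ->
  cos d < cos a -> `|a| < d.
Proof.
move=> /andP[d0 dpi] ad; rewrite -[cos a]cos_norm.
move: `|a| (normr_ge0 a) ad => {}a a0 ad da.
have [api|pia] := leP a pi.
  by rewrite -ltr_cos ?in_itv/= ?d0 ?a0.
have : cos (pi *+ 2 - a) < cos d.
  rewrite ltr_cos ?in_itv/= ?d0//; first lra.
  by apply/andP; split; move: ad pia; rewrite mulr2n; lra.
by rewrite -cosN opprB -(cosD2pi (a - pi *+ 2)) subrK ltNge ltW.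
Qed.

Lemma polar_angle (a b t : R) : a ^+ 2 + b ^+ 2 = 1 ->
  exists th, [/\ cos th = a, sin th = b & `|th - t| <= pi].
Proof.
move=> ab; have ct := cos2Dsin2 t.
(* Rotation by [- t], so that the angle within [pi] of [t] becomes a signed arc cosine. *)
pose a' := a * cos t + b * sin t; pose b' := b * cos t - a * sin t.
have ab' : a' ^+ 2 + b' ^+ 2 = 1.
  have -> : a' ^+ 2 + b' ^+ 2 = (a ^+ 2 + b ^+ 2) * (cos t ^+ 2 + sin t ^+ 2).
    by rewrite /a' /b'; ring.
  by rewrite ab ct mulr1.
have a'1 : -1 <= a' <= 1.
  rewrite -ler_norml -(expr_le1 (_ : 0 < 2)%N)// real_normK ?num_real//.
  by rewrite -ab' lerDl sqr_ge0.
have [d [cd sd dpi]] : exists d : R, [/\ cos d = a', sin d = b' & `|d| <= pi].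
  have sE : sin (acos a') = `|b'|.
    by rewrite sin_acos// -ab' addrAC subrr add0r sqrtr_sqr.
  have ca : cos (acos a') = a' by rewrite acosK// in_itv.
  have apos := acos_ge0 a'1; have api := acos_lepi a'1.
  have [b0|/ltW b0] := leP 0 b'.
    by exists (acos a'); rewrite sE ger0_norm// ger0_norm.
  exists (- acos a'); rewrite cosN sinN sE ler0_norm// opprK normrN.
  by rewrite ger0_norm.
exists (t + d); rewrite addrAC subrr add0r; split => //.
  rewrite cosD cd sd -[RHS]mulr1 -ct /a' /b'; ring.
by rewrite sinD cd sd -[RHS]mulr1 -ct /a' /b'; ring.
Qed.

(** Negativity on the boundary makes [v] timelike, hence a multiple of some [ray_gen (p, th)]. The
    angle [th] is fixed at one reference boundary point and then shown to serve all the others. *)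
Lemma invisible_lift f v : contracting_on (@disk R) f ->
  lipschitz1_on (@closed_disk R) f -> v != 0 ->
  (forall xi, circle xi -> ads_form v (ray_gen (xi, f xi)) < 0) ->
  exists x, [/\ disk x.1, ray_proj x = ray v &
    forall xi, circle xi -> `|x.2 - f xi| < sphere_dist x.1 xi].
Proof.
move=> fc flip v0 neg.
pose c2 := v 0 2 ^+ 2 + v 0 3 ^+ 2; pose s2 := v 0 0 ^+ 2 + v 0 1 ^+ 2.
have c20 : 0 <= c2 by rewrite addr_ge0// sqr_ge0.
have s20 : 0 <= s2 by rewrite addr_ge0// sqr_ge0.
pose vec a b d : 'rV[R]_3 := \row_(i < 3) [:: a; b; d]`_i.
have vecE a b d : [/\ vec a b d 0 0 = a, vec a b d 0 1 = b & vec a b d 0 2 = d].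
  by rewrite !mxE.
have dot_vec a b d : dot3 (vec a b d) (vec a b d) = a ^+ 2 + b ^+ 2 + d ^+ 2.
  by rewrite dot3E; have [-> -> ->] := vecE a b d; ring.
have timelike : c2 < s2.
  (* Otherwise test [v] against the boundary point over the direction of
     its last two coordinates. *)
  rewrite ltNge; apply/negP => sc.
  have c2_gt0 : 0 < c2.
    rewrite lt_neqAle c20 andbT eq_sym; apply: contra v0 => /eqP c2_0.
    have : s2 = 0 by apply/eqP; rewrite eq_le s20 andbT -c2_0.
    move: c2_0 => /eqP; rewrite paddr_eq0 ?sqr_ge0// !sqrf_eq0.
    move=> /andP[/eqP e2 /eqP e3] /eqP; rewrite paddr_eq0 ?sqr_ge0// !sqrf_eq0.
    move=> /andP[/eqP e0 /eqP e1].
    apply/eqP/rowP => i; rewrite mxE.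
    case: i => [[|[|[|[|//]]]] hi].
    - by rewrite -[RHS]e0; congr (v _ _); apply: val_inj.
    - by rewrite -[RHS]e1; congr (v _ _); apply: val_inj.
    - by rewrite -[RHS]e2; congr (v _ _); apply: val_inj.
    - by rewrite -[RHS]e3; congr (v _ _); apply: val_inj.
  pose r := Num.sqrt c2; have r0 : 0 < r by rewrite sqrtr_gt0.
  have r2 : r ^+ 2 = c2 by rewrite sqr_sqrtr.
  pose xi := vec (v 0 2 / r) (v 0 3 / r) 0.
  have Cxi : circle xi.
    split; last by case: (vecE (v 0 2 / r) (v 0 3 / r) 0).
    by rewrite dot_vec expr0n addr0 !expr_div_n -mulrDl r2 divff// gt_eqF.
  have := neg _ Cxi; rewrite /ads_form.
  have [-> -> -> ->] := ray_genE (xi, f xi).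
  have [/= -> -> _] := vecE (v 0 2 / r) (v 0 3 / r) 0.
  (* Cauchy-Schwarz in the time plane, through the Lagrange identity. *)
  have CS : (v 0 0 * cos (f xi) + v 0 1 * sin (f xi)) ^+ 2 <= r ^+ 2.
    rewrite r2; apply: le_trans sc.
    have -> : s2 = (v 0 0 * cos (f xi) + v 0 1 * sin (f xi)) ^+ 2 +
                   (v 0 0 * sin (f xi) - v 0 1 * cos (f xi)) ^+ 2.
      by rewrite /s2 -[LHS]mulr1 -(cos2Dsin2 (f xi)); ring.
    by rewrite lerDl sqr_ge0.
  have : v 0 0 * cos (f xi) + v 0 1 * sin (f xi) <= r.
    apply: le_trans (ler_norm _) _.
    by rewrite -(ler_pXn2r (_ : 0 < 2)%N) ?nnegrE ?(ltW r0)// real_normK ?num_real.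
  have rE : v 0 2 * (v 0 2 / r) + v 0 3 * (v 0 3 / r) = r.
    have -> : v 0 2 * (v 0 2 / r) + v 0 3 * (v 0 3 / r) = c2 / r.
      by rewrite /c2; ring.
    by rewrite -r2 expr2 mulfK// gt_eqF.
  by lra.
have s2_gt0 : 0 < s2 by exact: le_lt_trans timelike.
pose s := Num.sqrt s2; have s0 : 0 < s by rewrite sqrtr_gt0.
have ss : s ^+ 2 = s2 by rewrite sqr_sqrtr.
(* Scaling by [s] makes the time part a unit vector; the height completes the space part to a unit
   vector and is positive because [v] is timelike. *)
pose p := vec (v 0 2 / s) (v 0 3 / s) (Num.sqrt (1 - c2 / s2)).
have cs : 0 < 1 - c2 / s2 by rewrite subr_gt0 ltr_pdivrMr// mul1r.
have [p_0 p_1 p_2] := vecE (v 0 2 / s) (v 0 3 / s) (Num.sqrt (1 - c2 / s2)).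
have Dp : disk p.
  split; last by rewrite p_2 sqrtr_gt0.
  rewrite dot_vec sqr_sqrtr ?(ltW cs)// !expr_div_n -mulrDl ss.
  by rewrite addrC subrK.
pose xi0 := vec 1 0 0.
have Cxi0 : circle xi0.
  split; last by case: (vecE 1 0 0).
  by rewrite dot_vec expr1n !expr0n !addr0.
have [th [cth sth th_xi0]] : exists th, [/\ cos th = v 0 0 / s,
    sin th = v 0 1 / s & `|th - f xi0| <= pi].
  by apply: polar_angle; rewrite !expr_div_n -mulrDl ss divff// gt_eqF.
have vE : v = s *: ray_gen (p, th).
  have [e0 e1 e2 e3] := ray_genE (p, th).
  have sn : s != 0 by rewrite gt_eqF.
  apply/rowP => i; rewrite [RHS]mxE.
  case: i => [[|[|[|[|//]]]] hi].
  - have -> : Ordinal hi = 0 by apply: val_inj.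
    by rewrite e0 cth mulrC divfK.
  - have -> : Ordinal hi = 1 by apply: val_inj.
    by rewrite e1 sth mulrC divfK.
  - have -> : Ordinal hi = 2 by apply: val_inj.
    by rewrite e2 p_0 mulrC divfK.
  - have -> : Ordinal hi = 3 by apply: val_inj.
    by rewrite e3 p_1 mulrC divfK.
have hp : sphere p by case: Dp.
have cos_lt xi : circle xi -> cos (sphere_dist p xi) < cos (th - f xi).
  move=> Cxi; have [hxi _] := Cxi.
  have := neg _ Cxi; rewrite {1}vE ads_formZl pmulr_rlt0// ads_form_ray_gen//.
  by rewrite subr_lt0 cos_sphere_dist.
have d_range xi : circle xi -> 0 <= sphere_dist p xi <= pi.
  by move=> [hxi _]; rewrite sphere_dist_ge0// sphere_dist_lepi.
exists (p, th); split => //=.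
  by rewrite vE rayZ.
have closed xi : circle xi -> closed_disk xi by move=> [hxi x0]; split; rewrite ?x0.
(* By choice [th] is within [pi] of [f xi0], and [pi] is less than [pi *+ 2] minus the distance. *)
have lt0 : `|th - f xi0| < sphere_dist p xi0.
  apply: cos_gt_dist; [exact: d_range| |exact: cos_lt].
  have /andP[_] := disk_circle_dist Dp Cxi0; rewrite mulr2n; lra.
move=> xi Cxi; apply: cos_gt_dist; [exact: d_range| |exact: cos_lt].
have [hxi _] := Cxi; have [hxi0 _] := Cxi0.
have -> : th - f xi = (th - f xi0) + (f xi0 - f xi) by ring.
(* The sum is less than two sides of the triangle [p], [xi0], [xi], which the perimeter bound keeps
   at most [pi *+ 2] minus the third. *)
apply: le_lt_trans (ler_normD _ _) _.
have := flip _ _ (closed _ Cxi0) (closed _ Cxi).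
have := sphere_perimeter_le hp hxi0 hxi; rewrite (sphere_distC xi p); lra.
Qed.

End InvisibleDomain.

Theorem proposition8p15 (R : realType) (S : set ('rV[R]_3 * R))
    (hS : proper_spacelike_surface S) :
  invisible_domain [set ray_proj x | x in surface_boundary S] =
  [set ray_proj x | x in Cauchy_development S].
Proof.
have [f0 SE f0c] := surface_eq_graph hS.
have Dne : @disk R !=set0.
  by case: hS => SD [x /SD[Dx _]] _ _ _; exists x.1.
(* [f0] is controlled only on the disk; its extension describes the boundary as well. *)
have [f [ff0 flip]] := lipschitz_extension Dne f0c.
have fc : contracting_on (@disk R) f.
  by move=> p q Dp Dq; rewrite !ff0//; exact: f0c.
have {}flip : lipschitz1_on (@closed_disk R) f.
  by move=> p q [hp _] [hq _]; exact: flip.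
have SEf : S = graph_on (@disk R) f.
  by rewrite SE; apply/seteqP; split=> x [Dx xf]; split => //; rewrite xf ff0.
apply/seteqP; split=> [_ [v [v0 neg] <-]|_ [x Cx <-]].
  have [|x [Dx <- lt_d]] := invisible_lift fc flip v0.
    move=> xi Cxi; apply: neg; exists (xi, f xi) => //.
    by exists f; split.
  by exists x => //; rewrite SEf; exact: Cauchy_development_of_lt.
exists (ray_gen x) => //; split.
  apply/eqP => /rowP g0; have [e0 e1 _ _] := ray_genE x.
  have := cos2Dsin2 x.2; rewrite -e0 -e1 !g0 !mxE expr0n addr0 => /eqP.
  by rewrite eq_sym oner_eq0.
(* [w] is a positive multiple of [ray_gen y], so the sign can be read on the latter. *)
move=> w [y [g [SEg gc glip [Cy yg]]] rayE].
have : ray_proj y w by rewrite rayE; exact: ray_refl.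
move=> [a /= a0 <-]; rewrite -/(ray_gen y) ads_formZr pmulr_rlt0//.
rewrite ads_form_ray_gen// subr_lt0 -(cos_norm (x.2 - y.2)).
have hx : sphere x.1 by case: Cx => -[[]].
have [hy _] := Cy.
(* The boundary point comes with its own map [g], of which [S] is also the graph. *)
rewrite SEg in Cx; have := Cauchy_development_lt gc glip Cx Cy; rewrite -yg => lt_d.
have dpi := sphere_dist_lepi hx hy.
rewrite -cos_sphere_dist// ltr_cos// in_itv/= ?normr_ge0 ?sphere_dist_ge0//=.
exact: le_trans (ltW lt_d) dpi.
Qed.
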